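(* Let $\Phi$ be an ordinary Drinfeld $A$-module of rank $2$ over $L$, with characteristic polynomial of Frobenius $P_\Phi(X)=X^2-cX+\mu P^m$ and discriminant $\Delta=c^2-4\mu P^m$. Let $\rho$ be a prime ideal of $A$ different from the $A$-characteristic $P$ of $L$, such that $\rho^2\mid P_\Phi(1)$ and $\rho\mid (c-2)$. Then $\Phi(\rho)\subset L^{\Phi}$ if and only if $O(\Delta/\rho^2)\subset \mathrm{End}_L\Phi$.
   Context: Let $q$ be a prime power, $A=\mathbf{F}_q[T]$, $K=\mathbf{F}_q(T)$. Let $L$ be a finite field which is an extension of degree $n$ of $\mathbf{F}_q$, equipped with an $\mathbf{F}_q$-algebra homomorphism $\gamma:A\to L$; its kernel is a nonzero prime ideal, the $A$-characteristic of $L$, and $P$ denotes both this ideal and its monic generator. Put $d=\deg P$ and $m=[L:A/P]$, so $n=md$. Let $L\{\tau\}$ be the ring of polynomials in $\tau$ with multiplication determined by $\tau\lambda=\lambda^q\tau$ for $\lambda\in L$. It acts on any extension of $L$, with $\tau$ acting as $x\mapsto x^q$. A Drinfeld $A$-module of rank $2$ over $L$ is an $\mathbf{F}_q$-algebra homomorphism $\Phi:A\to L\{\tau\}$, $a\mapsto\Phi_a$, such that the constant coefficient of $\Phi_a$ is $\gamma(a)$ for all $a$, and $\Phi_T=\gamma(T)+a_1\tau+a_2\tau^2$ with $a_1,a_2\in L$, $a_2\neq0$. $L^{\Phi}$ denotes the additive group of $L$ with the $A$-module structure $a\cdot x=\Phi_a(x)$. $\Phi$ is supersingular if the module of $P$-division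 points $\{x\in\overline{L}:\Phi_P(x)=0\}$ is trivial, and ordinary otherwise. The Frobenius of $L$ is $F=\tau^n$. Its characteristic polynomial $P_\Phi$ (that of $F$ acting on the Tate modules of $\Phi$ at primes different from $P$) has the form $P_\Phi(X)=X^2-cX+\mu P^m$ with $c\in A$, $\mu\in\mathbf{F}_q^{*}$. $\mathrm{End}_L\Phi=\{u\in L\{\tau\}:u\Phi_a=\Phi_a u\ \forall a\in A\}$; it contains $A$ (via $\Phi$) and $F$, and for ordinary $\Phi$ of rank $2$ it is an $A$-order in the quadratic field $K(F)$. An ideal $\rho$ of $A$ is identified with a generator. $\Phi(\rho)=\{x\in\overline{L}:\Phi_\rho(x)=0\}$, which for $\rho$ prime to $P$ is isomorphic to $(A/\rho)^2$; the inclusion $\Phi(\rho)\subset L^\Phi$ is inside $\overline{L}$. The $A$-orders of $K(F)$ are the rings $A+gO_{K(F)}$, $g\in A\setminus\{0\}$, with $O_{K(F)}$ the maximal order, and are determined by their discriminants; $O(D)$ denotes the $A$-order of $K(F)$ with discriminant $D$. *)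

(* Defs.v *)
From HB Require Import structures.
From mathcomp Require Import all_boot all_order all_algebra all_field.
From mathcomp Require Import boolp classical_sets.

Set Implicit Arguments.
Unset Strict Implicit.
Unset Printing Implicit Defensive.

Import GRing.Theory.
Local Open Scope ring_scope.

(* Throughout, F is the field F_q with q = #|F|, {poly F} is A = F_q[T] (so   *)
(* that 'X : {poly F} is T), and L is a finite extension of F, of degree      *)
(* n = \dim {:L}.                                                             *)

Section FrobeniusPower.
Variables (F : finFieldType) (L : fieldExtType F).

Definition frobq (i : nat) (x : L) : L := x ^+ (#|F| ^ i).

Fact frobq_is_zmod_morphism i : zmod_morphism (frobq i).
Proof.
have [p p_pr pcharFp] := finPcharP F.
have pL : p \in [pchar L] by rewrite (fmorph_pchar (in_alg L)).
have qnat : [pchar L].-nat (#|F| ^ i)%N.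
  rewrite (eq_pnat _ (pcharf_eq pL)).
  by rewrite (card_pprimeChar pcharFp) -expnM pnatX pnat_id.
move=> x y; rewrite /frobq exprDn_pchar //; congr (_ + _).
apply/eqP; rewrite -addr_eq0 -exprDn_pchar // addNr expr0n expn_eq0.
by rewrite -leqn0 leqNgt (ltnW (finNzRing_gt1 F)).
Qed.

Fact frobq_is_monoid_morphism i : monoid_morphism (frobq i).
Proof. by split=> [|x y]; rewrite /frobq ?expr1n ?exprMn. Qed.

HB.instance Definition _ i :=
  GRing.isZmodMorphism.Build L L (frobq i) (frobq_is_zmod_morphism i).
HB.instance Definition _ i :=
  GRing.isMonoidMorphism.Build L L (frobq i) (frobq_is_monoid_morphism i).

Lemma frobqD i j x : frobq (i + j) x = frobq i (frobq j x).
Proof. by rewrite /frobq expnD mulnC exprM. Qed.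

Lemma frobq0 x : frobq 0 x = x. Proof. by []. Qed.

End FrobeniusPower.

(* The ring L{tau}: the left L-vector space of polynomials in tau, with the   *)
(* product given by (a tau^i) (b tau^j) = a b^(q^i) tau^(i + j).              *)
Definition skewpoly (F : finFieldType) (L : fieldExtType F) : Type := {poly L}.

Section SkewPoly.
Variables (F : finFieldType) (L : fieldExtType F).
Local Notation Ltau := (skewpoly L).

HB.instance Definition _ := GRing.Zmodule.copy Ltau {poly L}.

Definition skew_coefs (u : Ltau) : {poly L} := u.
Local Coercion skew_coefs : skewpoly >-> polynomial.

Definition skew_const (a : L) : Ltau := a%:P.
Definition skew_tau : Ltau := 'X.

Definition skew_mul (u v : Ltau) : Ltau :=
  \poly_(k < (size u + size v).-1)
    (\sum_(i < k.+1) u`_i * frobq i v`_(k - i)).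

Fact coef_skew_mul (u v : Ltau) k :
  (skew_mul u v)`_k = \sum_(i < k.+1) u`_i * frobq i v`_(k - i).
Proof.
rewrite /skew_mul /skew_coefs coef_poly ltn_predRL; case: leqP => // le_uv_k1.
rewrite big1 // => j _; have [lq_u_j|lt_j_u] := leqP (size u) j.
  by rewrite nth_default ?mul0r.
rewrite [v`__]nth_default ?rmorph0 ?mulr0 // leq_subRL -ltnS //.
by rewrite (leq_trans _ le_uv_k1) // ltn_add2r.
Qed.

Fact coef_skew_mul_rev (u v : Ltau) k :
  (skew_mul u v)`_k = \sum_(i < k.+1) u`_(k - i) * frobq (k - i) v`_i.
Proof.
rewrite coef_skew_mul (reindex_inj rev_ord_inj) /=.
by apply: eq_bigr => j _; rewrite (sub_ordK j).
Qed.

Fact skew_mulA : associative skew_mul.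
Proof.
move=> u v w; apply/polyP=> k; rewrite coef_skew_mul coef_skew_mul_rev.
pose coef3 i j :=
  u`_i * (frobq i v`_(k - i - j) * frobq i (frobq (k - i - j) w`_j)).
transitivity (\sum_(i < k.+1) \sum_(j < k.+1 | (j <= k - i)%N) coef3 i j).
  apply: eq_bigr => /= i _; rewrite coef_skew_mul_rev rmorph_sum big_distrr /=.
  rewrite (big_ord_narrow_leq (leq_subr _ _)).
  by apply: eq_bigr => j _; rewrite rmorphM.
rewrite (exchange_big_dep predT) //=; apply: eq_bigr => j _.
transitivity (\sum_(i < k.+1 | (i <= k - j)%N) coef3 i j).
  apply: eq_bigl => i; rewrite -ltnS -(ltnS i) -!subSn ?leq_ord //.
  by rewrite -subn_gt0 -(subn_gt0 i) -!subnDA addnC.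
rewrite (big_ord_narrow_leq (leq_subr _ _)) coef_skew_mul big_distrl /=.
apply: eq_bigr => i _; rewrite /coef3 mulrA -frobqD /= -!subnDA.
have le_ji : (j + i <= k)%N.
  by rewrite -leq_subRL ?leq_ord // -ltnS.
rewrite (addnC i) (_ : i + (k - (j + i)) = k - j)%N //.
by rewrite subnDA subnKC // leq_subRL ?leq_ord.
Qed.

Fact skew_1mul : left_id (skew_const 1) skew_mul.
Proof.
move=> u; apply/polyP => k; rewrite coef_skew_mul big_ord_recl subn0 frobq0.
by rewrite big1 => [|j _]; rewrite coefC ?mul1r ?addr0 ?mul0r.
Qed.

Fact skew_mul1 : right_id (skew_const 1) skew_mul.
Proof.
move=> u; apply/polyP => k; rewrite coef_skew_mul_rev big_ord_recl subn0.
by rewrite big1 => [|j _]; rewrite coefC ?rmorph1 ?mulr1 ?addr0 ?rmorph0 ?mulr0.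
Qed.

Fact skew_mulDl : left_distributive skew_mul +%R.
Proof.
move=> u v w; apply/polyP=> k; rewrite coefD !coef_skew_mul -big_split.
by apply: eq_bigr => j _; rewrite coefD mulrDl.
Qed.

Fact skew_mulDr : right_distributive skew_mul +%R.
Proof.
move=> u v w; apply/polyP=> k; rewrite coefD !coef_skew_mul -big_split.
by apply: eq_bigr => j _; rewrite coefD rmorphD mulrDr.
Qed.

Fact skew_const1_neq0 : skew_const 1 != 0.
Proof. by rewrite /skew_const polyC_eq0 oner_neq0. Qed.

HB.instance Definition _ := GRing.Zmodule_isNzRing.Build Ltau
  skew_mulA skew_1mul skew_mul1 skew_mulDl skew_mulDr skew_const1_neq0.

Definition skew_scale (c : F) (u : Ltau) : Ltau := c%:A *: skew_coefs u.

Fact skew_scaleA a b u : skew_scale a (skew_scale b u) = skew_scale (a * b) u.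
Proof. by rewrite /skew_scale /skew_coefs scalerA mulr_algl scalerA. Qed.

Fact skew_scale1 : left_id 1 skew_scale.
Proof. by move=> u; rewrite /skew_scale !scale1r. Qed.

Fact skew_scaleDr : right_distributive skew_scale +%R.
Proof. by move=> a u v; rewrite /skew_scale /skew_coefs -scalerDr. Qed.

Fact skew_scaleDl u : {morph skew_scale^~ u : a b / a + b}.
Proof. by move=> a b; rewrite /skew_scale /skew_coefs scalerDl scalerDl. Qed.

HB.instance Definition _ := GRing.Zmodule_isLmodule.Build F Ltau
  skew_scaleA skew_scale1 skew_scaleDr skew_scaleDl.

Fact skew_scaleAl (a : F) (u v : Ltau) : a *: (u * v) = a *: u * v.
Proof.
apply/polyP=> k; rewrite coefZ !coef_skew_mul mulr_sumr.
by apply: eq_bigr => i _; rewrite coefZ mulrA.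
Qed.

HB.instance Definition _ :=
  GRing.Lmodule_isLalgebra.Build F Ltau skew_scaleAl.

Lemma coef_skewM (u v : Ltau) k :
  (u * v)`_k = \sum_(i < k.+1) u`_i * frobq i v`_(k - i).
Proof. exact: coef_skew_mul. Qed.

Lemma skew_mulf_eq0 (u v : Ltau) : u * v = 0 -> u = 0 \/ v = 0.
Proof.
move=> uv0; have [->|u0] := eqVneq (u : {poly L}) 0; first by left.
have [->|v0] := eqVneq (v : {poly L}) 0; first by right.
case/negP: (oner_neq0 L); have: (u * v)`_((size u).-1 + (size v).-1) = 0.
  by rewrite uv0 coef0.
rewrite coef_skewM.
have lt_u : ((size u).-1 < ((size u).-1 + (size v).-1).+1)%N.
  by rewrite ltnS leq_addr.
rewrite (bigD1 (Ordinal lt_u)) ?big1 /= => [|i|//].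
  move/eqP; rewrite addr0 addKn mulf_eq0 fmorph_eq0 -!lead_coefE.
  by rewrite !lead_coef_eq0 (negPf u0) (negPf v0).
rewrite -val_eqE neq_ltn /= => /orP[lt_i|gt_i].
  rewrite [v`__]nth_default ?rmorph0 ?mulr0 // -addnBAC ?(ltnW lt_i) //.
  by rewrite -{1}[size v]prednK ?size_poly_gt0 // -add1n leq_add2r subn_gt0.
by move: gt_i; rewrite prednK ?size_poly_gt0 // => gt_i; rewrite nth_default ?mul0r.
Qed.

End SkewPoly.
Coercion skew_coefs : skewpoly >-> polynomial.

Section Frobenius.
Variables (F : finFieldType) (L : fieldExtType F).
Implicit Type u : skewpoly L.

(* The action of L{tau} on an extension j : L -> M, with tau acting as        *)
(* x |-> x^q.                                                                 *)
Definition skew_act (M : nzRingType) (j : L -> M) u (x : M) : M :=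
  \sum_(i < size u) j u`_i * x ^+ (#|F| ^ i).

Definition Frob : skewpoly L := skew_tau L ^+ \dim {:L}.

Lemma coef_tauXn n k : (skew_tau L ^+ n : skewpoly L)`_k = (k == n)%:R.
Proof.
elim: n k => [|n IHn] k; first by rewrite expr0 coefC; case: k.
rewrite exprS coef_skewM; case: k => [|k].
  by rewrite big_ord1 coefX mul0r.
rewrite big_ord_recl coefX mul0r add0r big_ord_recl coefX mul1r big1 ?addr0.
  by rewrite IHn subSS subn0 eqSS; case: eqP => _; rewrite ?rmorph1 ?rmorph0.
by move=> i _; rewrite coefX mul0r.
Qed.

Lemma frobq_dim (x : L) : frobq (\dim {:L}) x = x.
Proof. by apply/eqP; rewrite -Fermat's_little_theorem memvf. Qed.

Lemma Frob_central u : GRing.comm Frob u.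
Proof.
apply/polyP=> k; have -> : (u * Frob)`_k = \sum_(i < k.+1)
    u`_(k - i) * frobq (k - i) Frob`_i by exact: coef_skew_mul_rev.
rewrite coef_skewM; apply: eq_bigr => i _; rewrite coef_tauXn.
case: eqP => [->|_]; first by rewrite /= !mulr1n frobq_dim rmorph1 mul1r mulr1.
by rewrite /= !mulr0n rmorph0 mul0r mulr0.
Qed.

End Frobenius.
Arguments Frob {F} L.

(* Drinfeld A-modules of rank 2 over (L, gamma).                              *)
Record drinfeld_module2 (F : finFieldType) (L : fieldExtType F)
    (gamma : {lrmorphism {poly F} -> L}) := DrinfeldModule2 {
  drinfeld_map :> {lrmorphism {poly F} -> skewpoly L};
  drinfeld_const : forall a : {poly F}, (drinfeld_map a)`_0 = gamma a;
  drinfeld_rank2 : exists a1 a2 : L, a2 != 0 /\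
    drinfeld_map 'X = skew_const (gamma 'X) + skew_const a1 * skew_tau L
                      + skew_const a2 * skew_tau L ^+ 2 }.

(* The commutative domain A[F] generated by Phi(A) and F inside L{tau}, and   *)
(* its field of fractions K(F).                                               *)
Section FrobeniusField.
Variables (F : finFieldType) (L : fieldExtType F).
Variables (gamma : {lrmorphism {poly F} -> L}) (Phi : drinfeld_module2 gamma).

Fact Frob_comm : commr_rmorph Phi (Frob L).
Proof. by move=> a; apply: Frob_central. Qed.

Definition eval_Frob : {poly {poly F}} -> skewpoly L := horner_morph Frob_comm.

HB.instance Definition _ := GRing.RMorphism.on eval_Frob.

Definition in_AFrob : {pred skewpoly L} :=
  fun u => `[< exists p, u = eval_Frob p >].

Fact in_AFrobP u : reflect (exists p, u = eval_Frob p) (u \in in_AFrob).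
Proof. exact: asboolP. Qed.

Fact in_AFrob_subring : subring_closed in_AFrob.
Proof.
split=> [|_ _ /in_AFrobP[p ->] /in_AFrobP[r ->]
         |_ _ /in_AFrobP[p ->] /in_AFrobP[r ->]]; apply/in_AFrobP.
- by exists 1; rewrite rmorph1.
- by exists (p - r); rewrite rmorphB.
- by exists (p * r); rewrite rmorphM.
Qed.

HB.instance Definition _ :=
  GRing.isSubringClosed.Build (skewpoly L) in_AFrob in_AFrob_subring.

Record AFrob := MkAFrob { AFrob_val :> skewpoly L; _ : AFrob_val \in in_AFrob }.

HB.instance Definition _ := [isSub for AFrob_val].
HB.instance Definition _ := [Choice of AFrob by <:].
HB.instance Definition _ := [SubChoice_isSubNzRing of AFrob by <:].

Fact AFrob_mulC : commutative (@GRing.mul AFrob).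
Proof.
move=> x y; apply: val_inj; rewrite !rmorphM /=.
have /in_AFrobP[p ->] := valP x; have /in_AFrobP[r ->] := valP y.
by rewrite -!rmorphM mulrC.
Qed.

HB.instance Definition _ :=
  GRing.PzRing_hasCommutativeMul.Build AFrob AFrob_mulC.

Definition AFrob_unit : {pred AFrob} := fun x => `[< exists y, y * x = 1 >].
Definition AFrob_inv (x : AFrob) : AFrob := xget x [set y | y * x = 1].

Fact AFrob_mulVx : {in AFrob_unit, left_inverse 1 AFrob_inv *%R}.
Proof. by move=> x /asboolP; exact: xgetPex. Qed.

Fact AFrob_unitPl (x y : AFrob) : y * x = 1 -> AFrob_unit x.
Proof. by move=> yx1; apply/asboolP; exists y. Qed.

Fact AFrob_inv_out : {in [predC AFrob_unit], AFrob_inv =1 id}.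
Proof.
move=> x /negP nUx; rewrite /AFrob_inv; case: xgetP => // y _ /= yx1.
by case: nUx; apply/asboolP; exists y.
Qed.

HB.instance Definition _ := GRing.ComNzRing_hasMulInverse.Build AFrob
  AFrob_mulVx AFrob_unitPl AFrob_inv_out.

Fact AFrob_integral : GRing.integral_domain_axiom AFrob.
Proof.
move=> x y /(congr1 val); rewrite rmorphM rmorph0 => /skew_mulf_eq0.
by case=> xy0; apply/orP; [left | right]; apply/eqP/val_inj; apply: etrans xy0 _.
Qed.

HB.instance Definition _ :=
  GRing.ComUnitRing_isIntegral.Build AFrob AFrob_integral.

Definition KFrob := {fraction AFrob}.
HB.instance Definition _ := GRing.Field.on KFrob.

Fact AFrob_const_subproof (a : {poly F}) : Phi a \in in_AFrob.
Proof.
by apply/in_AFrobP; exists a%:P; rewrite /eval_Frob horner_morphC.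
Qed.

Definition AFrob_const (a : {poly F}) : AFrob :=
  MkAFrob (AFrob_const_subproof a).

Fact AFrob_const_is_zmod_morphism : zmod_morphism AFrob_const.
Proof.
move=> a b; apply: val_inj; rewrite rmorphB; exact: (rmorphB Phi).
Qed.

Fact AFrob_const_is_monoid_morphism : monoid_morphism AFrob_const.
Proof.
split=> [|a b]; apply: val_inj; first exact: (rmorph1 Phi).
by rewrite rmorphM; apply: (rmorphM Phi).
Qed.

HB.instance Definition _ := GRing.isZmodMorphism.Build {poly F} AFrob
  AFrob_const AFrob_const_is_zmod_morphism.
HB.instance Definition _ := GRing.isMonoidMorphism.Build {poly F} AFrob
  AFrob_const AFrob_const_is_monoid_morphism.

Definition KFrob_const (a : {poly F}) : KFrob := FracField.tofrac (AFrob_const a).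

HB.instance Definition _ := GRing.RMorphism.copy KFrob_const
  (@FracField.tofrac AFrob \o AFrob_const).

End FrobeniusField.

Local Open Scope classical_set_scope.

Section Orders.
Variables (F : finFieldType) (L : fieldExtType F).
Variables (gamma : {lrmorphism {poly F} -> L}) (Phi : drinfeld_module2 gamma).

Definition endomorphisms : set (skewpoly L) :=
  [set u | forall a : {poly F}, u * Phi a = Phi a * u].

(* The elements of K(F) that lie in End_L Phi: the fractions x / b, with x    *)
(* and b in A[F], such that x = b u in L{tau} for some u in End_L Phi.        *)
Definition endomorphisms_in_KFrob : set (KFrob Phi) :=
  [set z | exists u (x b : AFrob Phi), [/\ endomorphisms u, b != 0,
     AFrob_val x = AFrob_val b * u
   & z = FracField.tofrac x / FracField.tofrac b]].

Definition maximal_order : set (KFrob Phi) :=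
  [set z | integralOver (KFrob_const Phi) z].

Definition is_order (O : set (KFrob Phi)) : Prop :=
  exists2 g : {poly F}, g != 0 &
    O = [set z | exists a, exists2 w, maximal_order w &
                 z = KFrob_const Phi a + KFrob_const Phi g * w].

Definition is_order_basis (O : set (KFrob Phi)) (e : 'I_2 -> KFrob Phi) : Prop :=
  (forall z, O z <->
     exists a : 'I_2 -> {poly F}, z = \sum_i KFrob_const Phi (a i) * e i) /\
  (forall a : 'I_2 -> {poly F},
     \sum_i KFrob_const Phi (a i) * e i = 0 -> forall i, a i = 0).

(* t is the trace of multiplication by x, computed in the basis e.            *)
Definition is_trace (e : 'I_2 -> KFrob Phi) (x : KFrob Phi) (t : {poly F}) : Prop :=
  exists2 M : 'M[{poly F}]_2,
    forall j, x * e j = \sum_i KFrob_const Phi (M i j) * e i & t = \tr M.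

(* The discriminant of an order depends on the choice of an A-basis up to the *)
(* square of an element of F_q^*: having discriminant D means that some basis *)
(* gives D.                                                                   *)
Definition has_discriminant (O : set (KFrob Phi)) (D : {poly F}) : Prop :=
  exists2 e, is_order_basis O e &
    exists2 T : 'M[{poly F}]_2,
      forall i j, is_trace e (e i * e j) (T i j) & D = \det T.

(* O(D). As an order is determined by its discriminant, the choice made by    *)
(* xget is irrelevant whenever an order of discriminant D exists.             *)
Definition order_of_discriminant (D : {poly F}) : set (KFrob Phi) :=
  xget set0 [set O | is_order O /\ has_discriminant O D].

End Orders.

Section Torsion.
Variables (F : finFieldType) (L : fieldExtType F).
Variables (gamma : {lrmorphism {poly F} -> L}) (Phi : drinfeld_module2 gamma).
Variables (Lbar : closedFieldType) (iota : L -> Lbar).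

Local Notation A := {poly F}.
Local Notation act := (skew_act iota).

Definition torsion (a : A) : set Lbar := [set x | act (Phi a) x = 0].

Definition supersingular (P : A) : Prop := torsion P = [set 0].

Definition ordinary (P : A) : Prop := ~ supersingular P.

(* The Tate module T_l, as the inverse limit of the Phi(l^k).                 *)
Definition tate_module (l : A) : set (nat -> Lbar) :=
  [set x | (forall k, torsion (l ^+ k) (x k)) /\
           (forall k, act (Phi l) (x k.+1) = x k)].

(* An element of the completion A_l, the inverse limit of the A / l^k, is     *)
(* given by representatives a_k of its classes modulo l^k; it is zero when    *)
(* l^k divides a_k for all k.                                                 *)
Definition is_adic (l : A) (a : nat -> A) : Prop :=
  forall k, l ^+ k %| a k.+1 - a k.

Definition tate_comb r (a : 'I_r -> nat -> A) (e : 'I_r -> nat -> Lbar) :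
  nat -> Lbar := fun k => \sum_i act (Phi (a i k)) (e i k).

Definition is_tate_basis (l : A) r (e : 'I_r -> nat -> Lbar) : Prop :=
  [/\ forall i, tate_module l (e i),
      forall x, tate_module l x ->
        exists2 a, forall i, is_adic l (a i) & x = tate_comb a e
    & forall a, (forall i, is_adic l (a i)) -> tate_comb a e = (fun=> 0) ->
        forall i k, l ^+ k %| a i k].

(* p is the characteristic polynomial of F acting on T_l: its image in A_l[X] *)
(* is that of the matrix M over A_l of F in some A_l-basis e of T_l.          *)
Definition is_tate_char_poly (l : A) (p : {poly A}) : Prop :=
  exists r (e : 'I_r -> nat -> Lbar) (M : nat -> 'M[A]_r),
    [/\ is_tate_basis l e,
        forall i j, is_adic l (fun k => M k i j),
        forall j, (fun k => act (Frob L) (e j k)) =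
                  tate_comb (fun i k => M k i j) e
      & forall k i, l ^+ k %| (char_poly (M k) - p)`_i].

Definition is_Frob_char_poly (P : A) (p : {poly A}) : Prop :=
  forall l : A, irreducible_poly l -> ~~ (l %= P) -> is_tate_char_poly l p.

End Torsion.

(* [L : A/P], where A/P is identified with its image F_q(gamma(T)) in L.      *)
Definition residue_codegree (F : finFieldType) (L : fieldExtType F)
    (gamma : {lrmorphism {poly F} -> L}) : nat :=
  \dim_(<<1; gamma 'X>>%VS) {:L}.

Arguments endomorphisms_in_KFrob {F L gamma} Phi.
Arguments maximal_order {F L gamma} Phi.
Arguments order_of_discriminant {F L gamma} Phi D.

(* Main.v *)
(* The Cayley-Hamilton theorem on the Tate module at rho shows that P_Phi(F)  *)
(* kills Phi(rho^k) for all k; these kernels are unboundedly large, so        *)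
(* P_Phi(F) = 0 in L{tau}. Ordinarity keeps F out of Phi(A) and makes Delta   *)
(* nonzero: otherwise F or F^2 would be some Phi_a with P | a, and would kill *)
(* the nonzero P-division points. Hence K(F) is a separable quadratic field,  *)
(* the two divisibility hypotheses make w = (F - 1) / rho integral, and       *)
(* A + A w, whose discriminant is Delta / rho^2, is O(Delta / rho^2). The     *)
(* order A + A w lies in End_L Phi iff F - 1 = u Phi_rho for some u in        *)
(* L{tau}; as Phi_rho is separable, right division turns this into the        *)
(* condition that F - 1 vanishes on Phi(rho), i.e. that Phi(rho) lies in L.   *)

From HB Require Import structures.
Require Import Defs.
From mathcomp Require Import all_boot all_order all_algebra all_field.
From mathcomp Require Import boolp classical_sets.
From mathcomp Require Import ring.

Set Implicit Arguments.
Unset Strict Implicit.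
Unset Printing Implicit Defensive.

Import GRing.Theory.
Local Open Scope ring_scope.

(** * Division in L{tau} *)

(** Both sides are equivalent to one divisibility: F - 1 = u Phi_rho for some u in End_L Phi. On the
    torsion side ([torsion_rational_divides]), L is the fixed field of F, and an element of L{tau}
    that vanishes on the kernel of a separable element is a left multiple of it ([skew_kernel_sub]).
    On the order side ([order_gen_endomorphisms]), u is the fraction w = (F - 1) / rho, once O(Delta
    / rho^2) is known to be A + A w.

    That identity rests on P_Phi(F) = 0 ([eval_Frob_tate_char_poly]) and on ordinarity, which makes
    1 and F independent and Delta nonzero. As F - 1 has trace c - 2 and norm P_Phi(1), the
    hypotheses make w a root of some X^2 - t X + n over A with t^2 - 4 n = Delta / rho^2
    ([affine_change_quadratic]). The maximal order has a basis (1, o) ([maximal_order_basis]), so A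
    + g O_{K(F)} is A + A g o, of discriminant g^2 disc(o); hence a discriminant determines g up to
    a unit, and with it the order ([order_of_discriminantE]). *)

Section SkewPolyTheory.
Variables (F : finFieldType) (L : fieldExtType F).
Implicit Types u v w : skewpoly L.

Lemma coef_skew_constM (a : L) u k : (skew_const a * u : skewpoly L)`_k = a * u`_k.
Proof.
rewrite coef_skewM big_ord_recl subn0 coefC /= big1 ?addr0 // => i _.
by rewrite coefC mul0r.
Qed.

Lemma coef_skewM_tau u k :
  (u * skew_tau L : skewpoly L)`_k = if k is k'.+1 then u`_k' else 0.
Proof.
have -> : (u * skew_tau L : skewpoly L)`_k =
  \sum_(i < k.+1) u`_(k - i) * frobq (k - i) (skew_tau L)`_i.
  exact: coef_skew_mul_rev.
rewrite big_ord_recl coefX rmorph0 mulr0 add0r.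
case: k => [|k]; first by rewrite big_ord0.
rewrite big_ord_recl coefX rmorph1 mulr1 subSS subn0 big1 ?addr0 // => i _.
by rewrite coefX rmorph0 mulr0.
Qed.

Lemma coef_tauM u k :
  (skew_tau L * u : skewpoly L)`_k = if k is k'.+1 then frobq 1 u`_k' else 0.
Proof.
rewrite coef_skewM big_ord_recl coefX mul0r add0r.
case: k => [|k]; first by rewrite big_ord0.
rewrite big_ord_recl coefX mul1r subSS subn0 big1 ?addr0 // => i _.
by rewrite coefX mul0r.
Qed.

Lemma skew_coefsD u v k : (u + v : skewpoly L)`_k = u`_k + v`_k.
Proof. exact: coefD. Qed.

Lemma skew_coefsB u v k : (u - v : skewpoly L)`_k = u`_k - v`_k.
Proof. exact: coefB. Qed.

Lemma skewP u v : (forall k, u`_k = v`_k) -> u = v.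
Proof. by move=> uv; apply/polyP. Qed.

Lemma size_skew_eq0 u : (size u == 0)%N = (u == 0).
Proof. exact: size_poly_eq0. Qed.

Lemma size_skewM u v : u != 0 -> v != 0 ->
  size (u * v : skewpoly L) = (size u + size v).-1.
Proof.
move=> u0 v0; apply/eqP; rewrite eqn_leq; apply/andP; split.
  exact: size_poly.
have su : (0 < size u)%N by rewrite lt0n size_skew_eq0.
have sv : (0 < size v)%N by rewrite lt0n size_skew_eq0.
have -> : ((size u + size v).-1 = ((size u).-1 + (size v).-1).+1)%N.
  by rewrite -(prednK su) -(prednK sv) /= addnS.
apply: contraT; rewrite -leqNgt => le_uv.
have := nth_default 0 le_uv; rewrite coef_skewM.
have lt_u : ((size u).-1 < ((size u).-1 + (size v).-1).+1)%N.
  by rewrite ltnS leq_addr.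
rewrite (bigD1 (Ordinal lt_u)) ?big1 /= => [|i|//].
  move/eqP; rewrite addr0 addKn mulf_eq0 fmorph_eq0 -!lead_coefE.
  by rewrite !lead_coef_eq0 (negPf u0) (negPf v0).
rewrite -val_eqE neq_ltn /= => /orP[lt_i|gt_i].
  rewrite [v`__]nth_default ?rmorph0 ?mulr0 // -addnBAC ?(ltnW lt_i) //.
  by rewrite -{1}(prednK sv) -add1n leq_add2r subn_gt0.
by move: gt_i; rewrite prednK // => gt_i; rewrite nth_default ?mul0r.
Qed.

Lemma skew_mulIf u : u != 0 -> injective ( *%R^~ u).
Proof.
move=> u0 v w /eqP; rewrite -subr_eq0 -mulrBl => /eqP/skew_mulf_eq0[/subr0_eq //|].
by move/eqP; rewrite (negPf u0).
Qed.

Lemma skew_mulfI u : u != 0 -> injective ( *%R u).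
Proof.
move=> u0 v w /eqP; rewrite -subr_eq0 -mulrBr => /eqP/skew_mulf_eq0[|/subr0_eq //].
by move/eqP; rewrite (negPf u0).
Qed.

(** The leading coefficient of a tau^e u is a times the q^e-th power of that of [u], so any leading
    term can be cancelled by a left multiple of [u]; with [u] on the right, no q-th roots have to be
    taken in L. *)
Lemma skew_rdiv u v : u != 0 -> exists w r, v = w * u + r /\ (size r < size u)%N.
Proof.
move=> u0; have su : (0 < size u)%N by rewrite lt0n size_skew_eq0.
have [n] := ubnP (size v); elim: n v => // n IHn v; rewrite ltnS => le_v_n.
have [lt_vu|le_uv] := ltnP (size v) (size u).
  by exists 0, v; rewrite mul0r add0r.
set e := (size v - size u)%N.
pose a := v`_(size v).-1 / frobq e u`_(size u).-1.
pose t : skewpoly L := skew_const a * skew_tau L ^+ e.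
have coef_t k : t`_k = (k == e)%:R * a.
  by rewrite coef_skew_constM coef_tauXn mulrC.
have coef_tu k : (t * u : skewpoly L)`_k =
    if (e <= k)%N then a * frobq e u`_(k - e) else 0.
  rewrite coef_skewM; have [le_ek|lt_ke] := leqP e k.
    rewrite (bigD1 (Ordinal (le_ek : (e < k.+1)%N))) //= big1 ?addr0.
      by rewrite coef_t eqxx mul1r.
    by move=> i; rewrite -val_eqE /= coef_t => /negPf->; rewrite !mul0r.
  rewrite big1 // => i _; rewrite coef_t ltn_eqF ?mul0r //.
  exact: leq_ltn_trans (leq_ord i) lt_ke.
have sv : (0 < size v)%N by apply: leq_trans le_uv.
have [|w [r [def_r lt_r]]] := IHn (v - t * u).
  apply: leq_trans (_ : (size v).-1 < n)%N; last by rewrite prednK.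
  rewrite ltnS; apply/leq_sizeP => k le_k; rewrite skew_coefsB coef_tu.
  have le_ek : (e <= k)%N.
    by apply: leq_trans le_k; rewrite /e -subn1 leq_sub2l.
  rewrite le_ek; move: le_k; rewrite leq_eqVlt => /predU1P[<-|].
    have -> : ((size v).-1 - e = (size u).-1)%N.
      by rewrite -!subn1 subnAC /e subKn.
    rewrite /a divfK ?subrr // fmorph_eq0 -lead_coefE lead_coef_eq0 //.
  rewrite prednK // => le_vk; rewrite nth_default // [u`__]nth_default.
    by rewrite rmorph0 mulr0 subr0.
  by rewrite leq_subRL // /e subnK.
exists (w + t), r; split=> //.
by rewrite mulrDl addrAC -def_r subrK.
Qed.

End SkewPolyTheory.

(** * The action of L{tau} *)

Section SkewAction.
Variables (F : finFieldType) (L : fieldExtType F).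
Variables (M : fieldType) (iota : {rmorphism L -> M}).
Implicit Types (u v w : skewpoly L) (x y : M).
Local Notation act := (skew_act iota).
Local Notation q := #|F|.

Lemma skew_act_bound N u x : (size u <= N)%N ->
  act u x = \sum_(i < N) iota u`_i * x ^+ (q ^ i).
Proof.
move=> le_uN; rewrite /skew_act.
rewrite (big_ord_widen N (fun i => iota u`_i * x ^+ (q ^ i))) //.
rewrite big_mkcond /=; apply: eq_bigr => i _; case: ltnP => // le_ui.
by rewrite nth_default // rmorph0 mul0r.
Qed.

Lemma exprqD i x y : (x + y) ^+ (q ^ i) = x ^+ (q ^ i) + y ^+ (q ^ i).
Proof.
have [p p_pr pcharFp] := finPcharP F.
have pM : p \in [pchar M] by rewrite (fmorph_pchar (iota \o in_alg L)).
rewrite exprDn_pchar // (eq_pnat _ (pcharf_eq pM)).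
by rewrite (card_pprimeChar pcharFp) -expnM pnatX pnat_id.
Qed.

Lemma exprq0 i : 0 ^+ (q ^ i) = 0 :> M.
Proof. by apply: (addrI (0 ^+ (q ^ i))); rewrite -exprqD !addr0. Qed.

Lemma skew_act_is_nmod_morphism u : nmod_morphism (act u).
Proof.
split=> [|x y]; first by rewrite /skew_act big1 // => i _; rewrite exprq0 mulr0.
by rewrite /skew_act -big_split; apply: eq_bigr => i _; rewrite exprqD mulrDr.
Qed.

HB.instance Definition _ u :=
  GRing.isNmodMorphism.Build M M (act u) (skew_act_is_nmod_morphism u).

Lemma skew_actD u v x : act (u + v) x = act u x + act v x.
Proof.
rewrite (@skew_act_bound (maxn (size u) (size v)) u) ?leq_maxl //.
rewrite (@skew_act_bound (maxn (size u) (size v)) v) ?leq_maxr //.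
rewrite (@skew_act_bound (maxn (size u) (size v))) ?size_polyD //.
by rewrite -big_split; apply: eq_bigr => i _; rewrite skew_coefsD rmorphD mulrDl.
Qed.

Lemma skew_act0 x : act 0 x = 0.
Proof. by rewrite (@skew_act_bound 0) ?big_ord0 // size_poly0. Qed.

Lemma skew_actB u v x : act (u - v) x = act u x - act v x.
Proof. by apply/eqP; rewrite eq_sym subr_eq -skew_actD subrK. Qed.

Lemma skew_act_constM a u x : act (skew_const a * u) x = iota a * act u x.
Proof.
rewrite (@skew_act_bound (size u)).
  rewrite mulr_sumr; apply: eq_bigr => i _.
  by rewrite coef_skew_constM rmorphM mulrA.
by apply/leq_sizeP => k le_uk; rewrite coef_skew_constM nth_default ?mulr0.
Qed.

Lemma skew_act_const a x : act (skew_const a) x = iota a * x.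
Proof.
by rewrite (@skew_act_bound 1) ?size_polyC_leq1 // big_ord1 coefC expr1.
Qed.

Lemma skew_act_Mtau u x : act (u * skew_tau L) x = act u (x ^+ q).
Proof.
rewrite (@skew_act_bound (size u).+1).
  rewrite big_ord_recl coef_skewM_tau rmorph0 mul0r add0r.
  by apply: eq_bigr => i _; rewrite coef_skewM_tau expnS exprM.
by apply/leq_sizeP => -[|k] le_uk //; rewrite coef_skewM_tau nth_default.
Qed.

Lemma skew_act_tauM u x : act (skew_tau L * u) x = act u x ^+ q.
Proof.
rewrite (@skew_act_bound (size u).+1).
  rewrite big_ord_recl coef_tauM rmorph0 mul0r add0r.
  have ->: act u x ^+ q = \sum_(i < size u) (iota u`_i * x ^+ (q ^ i)) ^+ q.
    have powD y z : (y + z) ^+ q = y ^+ q + z ^+ q by rewrite -[q]expn1 exprqD.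
    have pow0 : 0 ^+ q = 0 :> M by rewrite -[q]expn1 exprq0.
    by rewrite /skew_act (big_morph _ powD pow0).
  apply: eq_bigr => i _; rewrite coef_tauM /frobq expn1.
  by rewrite exprMn rmorphXn -exprM mulnC -expnS.
by apply/leq_sizeP => -[|k] le_uk //; rewrite coef_tauM nth_default // rmorph0.
Qed.

(** Induction on the degree of [u], written as u' tau + u_0: associativity leaves only left
    multiplication by tau and by constants to check. *)
Lemma skew_actM u v x : act (u * v) x = act u (act v x).
Proof.
have [n] := ubnP (size u); elim: n => // n IHn in u v x *; rewrite ltnS => le_un.
pose u' : skewpoly L := \poly_(i < n.-1) u`_i.+1.
have def_u : u = u' * skew_tau L + skew_const u`_0.
  apply: skewP => k; rewrite skew_coefsD coef_skewM_tau coefC.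
  case: k => [|k]; first by rewrite add0r.
  rewrite addr0 coef_poly; case: ltnP => // le_nk; rewrite nth_default //.
  by apply: leq_trans le_un _; case: (n) le_nk.
have [n0|n_gt0] := posnP n.
  move: le_un; rewrite n0 leqn0 size_skew_eq0 => /eqP->.
  by rewrite mul0r !skew_act0.
have lt_u' : (size u' < n)%N.
  by rewrite -[n]prednK // ltnS size_poly.
rewrite def_u mulrDl skew_actD -mulrA IHn // skew_act_tauM skew_act_constM.
by rewrite skew_actD skew_act_Mtau skew_act_const.
Qed.

Lemma skew_act1 x : act 1 x = x.
Proof. by rewrite skew_act_const rmorph1 mul1r. Qed.

Lemma skew_act_tauX n x : act (skew_tau L ^+ n) x = x ^+ (q ^ n).
Proof.
elim: n => [|n IHn]; first by rewrite expr0 skew_act1 expn0 expr1.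
by rewrite exprS skew_act_tauM IHn -exprM expnSr.
Qed.

(** The additive polynomial of [u], through which root counting and separability apply to the kernel
    of [u]. *)
Definition skew_lin u : {poly M} := \sum_(i < size u) iota u`_i *: 'X^(q ^ i).

Lemma horner_skew_lin u x : (skew_lin u).[x] = act u x.
Proof.
by rewrite horner_sum; apply: eq_bigr => i _; rewrite hornerZ hornerXn.
Qed.

Lemma size_skew_lin u : u != 0 -> size (skew_lin u) = (q ^ (size u).-1).+1.
Proof.
move=> u0; have lu0 : iota u`_(size u).-1 != 0.
  by rewrite fmorph_eq0 -lead_coefE lead_coef_eq0.
rewrite /skew_lin; case su: (size u) lu0 => [|n] lu0.
  by move/eqP: su; rewrite size_skew_eq0 (negPf u0).
rewrite big_ord_recr /= addrC size_polyDl size_scale ?size_polyXn //.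
rewrite ltnS; apply/leq_sizeP => k le_k; rewrite coef_sum big1 // => i _.
rewrite coefZ coefXn gtn_eqF ?mulr0 // (leq_trans _ le_k) //.
by rewrite ltn_exp2l ?finNzRing_gt1.
Qed.

(** As q vanishes in [M], each X^(q^i) with i > 0 has derivative zero. *)
Lemma skew_lin_deriv u : (skew_lin u)^`() = (iota u`_0)%:P.
Proof.
have [p p_pr pcharFp] := finPcharP F.
have pM : p \in [pchar M] by rewrite (fmorph_pchar (iota \o in_alg L)).
have qM : (q%:R : M) = 0.
  have := finNzRing_gt1 F; rewrite (card_pprimeChar pcharFp).
  by case: logn => // n _; rewrite expnS natrM pcharf0 // mul0r.
rewrite /skew_lin linear_sum /=; case su: (size u) => [|n].
  by rewrite big_ord0 nth_default ?su // rmorph0.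
rewrite big_ord_recl big1 ?addr0 => [|i _].
  by rewrite derivZ derivXn expr0 -[1 *+ _]/1 alg_polyC.
rewrite derivZ derivXn /= -mulr_natl expnS natrM -polyC_natr qM.
by rewrite mul0r mul0r scaler0.
Qed.
End SkewAction.

(** * Kernels of the action and right divisibility *)

Section SkewKernel.
Variables (F : finFieldType) (L : fieldExtType F).
Variables (M : closedFieldType) (iota : {rmorphism L -> M}).
Implicit Types (u v w : skewpoly L) (x y : M).
Local Notation act := (skew_act iota).
Local Notation q := #|F|.

Lemma skew_act_surj u y : (1 < size u)%N -> exists x, act u x = y.
Proof.
move=> su; have u0 : u != 0 by rewrite -size_skew_eq0; case: size su.
have [|x] := closed_rootP (skew_lin iota u - y%:P) _.
  rewrite size_polyDl size_skew_lin //.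
    rewrite eqSS expn_eq0 negb_and -lt0n.
    by rewrite (leq_trans _ (finNzRing_gt1 F)).
  rewrite size_polyN (leq_ltn_trans (size_polyC_leq1 _)) // ltnS expn_gt0.
  by rewrite (ltnW (finNzRing_gt1 F)).
by rewrite rootE !hornerE horner_skew_lin subr_eq0 => /eqP; exists x.
Qed.

(* The roots are simple: the additive polynomial of u has derivative u_0. *)
Lemma skew_kernel_card u : u`_0 != 0 ->
  exists s : seq M,
    [/\ uniq s, size s = (q ^ (size u).-1)%N & {in s, forall x, act u x = 0}].
Proof.
move=> u00; have u0 : u != 0 by apply: contraNneq u00 => ->; rewrite coef0.
have [s def_s] := closed_field_poly_normal (skew_lin iota u).
have l0 : lead_coef (skew_lin iota u) != 0.
  by rewrite lead_coef_eq0 -size_poly_eq0 size_skew_lin.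
exists s; split=> [||x xs].
- rewrite -separable_prod_XsubC -(eqp_separable (eqp_scale _ l0)) -def_s.
  have -> : separable_poly (skew_lin iota u) =
            coprimep (skew_lin iota u) (skew_lin iota u)^`() by rewrite unlock.
  rewrite skew_lin_deriv (eqp_coprimepr _ (_ : _ %= 1)) ?coprimep1 //.
  by rewrite polyC_eqp1 fmorph_eq0.
- have := size_skew_lin iota u0.
  by rewrite {1}def_s size_scale // size_prod_XsubC => -[].
- by rewrite -horner_skew_lin; apply/rootP; rewrite def_s rootZ // root_prod_XsubC.
Qed.

(** The remainder of [v] on division by [u] vanishes on the kernel of [u], which has q^(deg u)
    points by separability. A nonzero remainder has an additive polynomial of smaller degree, too
    small for so many roots. *)
Lemma skew_kernel_sub u v : u`_0 != 0 ->
  (forall x, act u x = 0 -> act v x = 0) -> exists w, v = w * u.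
Proof.
move=> u00 ker_uv; have u0 : u != 0 by apply: contraNneq u00 => ->; rewrite coef0.
have [w [r [def_v lt_ru]]] := skew_rdiv v u0; exists w.
have [r0|r0] := eqVneq r 0; first by rewrite def_v r0 addr0.
have [s [uniq_s size_s ker_s]] := skew_kernel_card u00.
have lin_r0 : skew_lin iota r != 0 by rewrite -size_poly_eq0 size_skew_lin.
have roots_s : all (root (skew_lin iota r)) s.
  apply/allP => x /ker_s ux0; rewrite rootE horner_skew_lin.
  have := ker_uv x ux0; rewrite def_v skew_actD skew_actM ux0 raddf0 add0r.
  by move=> ->.
have := max_poly_roots lin_r0 roots_s uniq_s.
rewrite size_s size_skew_lin // ltnS leq_exp2l ?finNzRing_gt1 //.
by rewrite leqNgt -ltnS !prednK ?lt_ru // lt0n size_skew_eq0.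
Qed.

End SkewKernel.

(** * The Frobenius relation *)

Section DrinfeldTheory.
Variables (F : finFieldType) (L : fieldExtType F).
Variables (gamma : {lrmorphism {poly F} -> L}) (Phi : drinfeld_module2 gamma).

Lemma drinfeld_polyC (c : F) : Phi c%:P = skew_const c%:A :> skewpoly L.
Proof.
rewrite -alg_polyC linearZ rmorph1.
by apply: skewP => k; rewrite coefZ !coefC; case: eqP; rewrite ?mulr1 ?mulr0.
Qed.

Lemma size_drinfeldX : size (Phi 'X) = 3%N.
Proof.
have [a1 [a2 [a20 ->]]] := drinfeld_rank2 Phi.
have -> : skew_const (gamma 'X) + skew_const a1 * skew_tau L +
   skew_const a2 * skew_tau L ^+ 2 =
   a2 *: 'X^2 + (a1 *: 'X + (gamma 'X)%:P) :> {poly L}.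
  apply/polyP => k; rewrite [RHS]coefD [X in _ = _ + X]coefD !coefZ coefXn coefX.
  rewrite 2!skew_coefsD !coef_skew_constM -[skew_tau L]expr1 -exprM !coef_tauXn.
  by rewrite addrC (addrC (_ * (k == 1%N)%:R)).
rewrite size_polyDl size_scale ?size_polyXn // ltnS.
rewrite (leq_trans (size_polyD _ _)) // geq_max.
rewrite (leq_trans (size_scale_leq _ _)) ?size_polyX //.
by rewrite (leq_trans (size_polyC_leq1 _)).
Qed.

Lemma size_drinfeld a : a != 0 -> size (Phi a) = (size a).-1.*2.+1.
Proof.
elim/poly_ind: a => [|a c IHa]; first by rewrite eqxx.
have X0 : Phi 'X != 0 by rewrite -size_skew_eq0 size_drinfeldX.
have [-> | a0 _] := eqVneq a 0.
  rewrite mul0r add0r polyC_eq0 drinfeld_polyC => c0.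
  by rewrite !size_polyC scaler_eq0 oner_eq0 orbF c0.
have Phia0 : Phi a != 0 by rewrite -size_skew_eq0 IHa.
have -> : Phi (a * 'X + c%:P) = Phi a * Phi 'X + skew_const c%:A.
  by rewrite -drinfeld_polyC rmorphD rmorphM.
rewrite size_polyDl.
  rewrite size_skewM // size_drinfeldX IHa // size_MXaddC (negPf a0) /= addn3 /=.
  by rewrite -doubleS prednK // size_poly_gt0.
rewrite size_skewM // size_drinfeldX IHa // addn3 /=.
by rewrite (leq_ltn_trans (size_polyC_leq1 _)).
Qed.

Lemma drinfeld_eq0 a : (Phi a == 0) = (a == 0).
Proof.
have [->|a0] := eqVneq a 0; first by rewrite rmorph0 eqxx.
by rewrite -size_skew_eq0 size_drinfeld.
Qed.

Lemma drinfeldC a b : Phi a * Phi b = Phi b * Phi a.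
Proof. by rewrite -!rmorphM mulrC. Qed.

Lemma eval_FrobC a : eval_Frob Phi a%:P = Phi a.
Proof. exact: horner_morphC. Qed.

Lemma eval_FrobX : eval_Frob Phi 'X = Frob L.
Proof. exact: horner_morphX. Qed.

Variables (M : closedFieldType) (iota : {rmorphism L -> M}).
Local Notation act := (skew_act iota).

Lemma eval_Frob_act_sum I r (P : pred I) (p : I -> {poly {poly F}}) x :
  act (eval_Frob Phi (\sum_(i <- r | P i) p i)) x =
  \sum_(i <- r | P i) act (eval_Frob Phi (p i)) x.
Proof.
rewrite rmorph_sum; apply: (big_morph (fun u => act u x)).
  by move=> u v; exact: skew_actD.
exact: skew_act0.
Qed.

(* Multiply the system (X - M) e = 0 by the adjugate of X - M. *)
Lemma Cayley_Hamilton_act r (e : 'I_r -> M) (A : 'M[{poly F}]_r) :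
  (forall j, act (Frob L) (e j) = \sum_i act (Phi (A i j)) (e i)) ->
  forall l, act (eval_Frob Phi (char_poly A)) (e l) = 0.
Proof.
move=> FA l; set N := char_poly_mx A.
have Ne j : \sum_i act (eval_Frob Phi (N i j)) (e i) = 0.
  transitivity (\sum_i (act (Frob L) (e i) *+ (i == j) - act (Phi (A i j)) (e i))).
    apply: eq_bigr => i _; rewrite !mxE rmorphB skew_actB /= eval_FrobC; congr (_ - _).
    by case: eqP; rewrite ?eval_FrobX // rmorph0 skew_act0.
  rewrite sumrB -FA (bigD1 j) //= eqxx big1 ?addr0 ?subrr // => i /negPf->.
  by rewrite mulr0n.
transitivity (\sum_i act (eval_Frob Phi ((N *m \adj N) i l)) (e i)).
  rewrite mul_mx_adj (bigD1 l) //= big1 ?addr0 => [|i /negPf il].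
    by rewrite !mxE eqxx.
  by rewrite !mxE il rmorph0 skew_act0.
transitivity (\sum_i \sum_j act (eval_Frob Phi (\adj N j l))
                           (act (eval_Frob Phi (N i j)) (e i))).
  apply: eq_bigr => i _; rewrite mxE eval_Frob_act_sum; apply: eq_bigr => j _.
  by rewrite mulrC rmorphM skew_actM.
rewrite exchange_big big1 // => j _; rewrite -raddf_sum Ne.
exact: raddf0.
Qed.

Lemma drinfeld_actM a b x : act (Phi (a * b)) x = act (Phi a) (act (Phi b) x).
Proof. by rewrite rmorphM skew_actM. Qed.

Lemma torsion_dvd a b x : a %| b -> torsion Phi iota a x -> torsion Phi iota b x.
Proof.
by move=> /dvdpP[c ->]; rewrite /torsion /= drinfeld_actM => ->; exact: raddf0.
Qed.

(** [Phi l] acts surjectively on the closed field, so [x] can be divided by [l] forever: multiples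
    of [x] fill the levels below [k], successive preimages those above. *)
Lemma torsion_tate_module (l : {poly F}) k x : (1 < size l)%N -> torsion Phi iota (l ^+ k) x ->
  exists2 y, tate_module Phi iota l y & y k = x.
Proof.
move=> sl lkx.
have /choice[g gK] : forall y, exists z, act (Phi l) z = y.
  move=> y; apply: skew_act_surj; rewrite size_drinfeld -?size_poly_gt0 ?(ltnW sl) //.
  by case: (size l) sl => [|[|n]].
pose s i := iter i g x.
have sK i j : act (Phi (l ^+ i)) (s (i + j)%N) = s j.
  elim: i => [|i IHi]; first by rewrite expr0 rmorph1 skew_act1.
  by rewrite exprSr drinfeld_actM addSn gK.
(* Subtraction is truncated, so one of [k - j] and [j - k] is always 0 and this formula serves both
   ranges of levels. *)
exists (fun j => act (Phi (l ^+ (k - j))) (s (j - k)%N)); last first.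
  by rewrite subnn expr0 rmorph1 skew_act1.
split=> j; rewrite /torsion /= -drinfeld_actM -?exprD -?exprS; last first.
  have [lt_jk|le_kj] := ltnP j k.
    by rewrite subnSK // (eqP (lt_jk : (_ - _)%N == 0%N)) (eqP (ltnW lt_jk : (_ - _)%N == 0%N)).
  rewrite (eqP (leqW le_kj : (_ - _)%N == 0%N)) (eqP (le_kj : (_ - _)%N == 0%N)).
  by rewrite subSn // expr1 expr0 rmorph1 skew_act1 gK.
have [le_jk|lt_kj] := leqP j k.
  by rewrite subnKC // (eqP (le_jk : (_ - _)%N == 0%N)).
rewrite (eqP (ltnW lt_kj : (_ - _)%N == 0%N)) addn0.
rewrite -{1}(subnKC (ltnW lt_kj)) exprD drinfeld_actM.
by have := sK (j - k)%N 0; rewrite addn0 => ->.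
Qed.

(** Since [gamma l] is nonzero, every [Phi (l ^+ k)] is separable and so divides [u] on the right;
    its tau-degree is 2 k deg l, which exceeds that of a nonzero [u] as soon as k is [size u]. *)
Lemma drinfeld_kernel_eq0 (l : {poly F}) u : (1 < size l)%N -> gamma l != 0 ->
  (forall k x, torsion Phi iota (l ^+ k) x -> act u x = 0) -> u = 0.
Proof.
move=> sl gl ker_u; apply/eqP; apply: contraT => u0.
have l0 k : l ^+ k != 0 by rewrite expf_neq0 // -size_poly_gt0 ltnW.
have [w def_u] : exists w, u = w * Phi (l ^+ size u).
  apply: (@skew_kernel_sub _ _ _ iota); last exact: ker_u.
  by rewrite drinfeld_const rmorphXn expf_neq0.
have w0 : w != 0 by apply: contraNneq u0 => w0; rewrite def_u w0 mul0r.
have Pl0 : Phi (l ^+ size u) != 0 by rewrite drinfeld_eq0.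
have := congr1 (fun v : skewpoly L => size v) def_u.
rewrite size_skewM // size_drinfeld // addnS /= size_exp => /eqP.
rewrite eqn_leq => /andP[_].
have : (0 < size w)%N by rewrite lt0n size_skew_eq0.
case: (size w) => // n _; have : (0 < (size l).-1)%N by case: (size l) sl => [|[]].
case: (size l).-1 => // d _; rewrite addSn mulSn -addnn => /(leq_trans _) le_u.
have := le_u (size u).+1; rewrite ltnn => /(_ _)/negP[]//.
by rewrite ltnS -[leqLHS]add0n leq_add // -addnA leq_addr.
Qed.

Lemma eval_Frob_act_dvd (l : {poly F}) (p : {poly {poly F}}) x :
  (forall i, l %| p`_i) -> torsion Phi iota l x ->
  act (eval_Frob Phi p) x = 0.
Proof.
move=> l_p lx; rewrite -[p]coefK poly_def eval_Frob_act_sum big1 // => i _.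
rewrite -mul_polyC mulrC rmorphM skew_actM /= eval_FrobC.
by have /= -> := torsion_dvd (l_p i) lx; exact: raddf0.
Qed.

(** At level k, Cayley-Hamilton and the congruence of characteristic polynomials modulo l^k show
    that p(F) kills the k-th components of the Tate basis. Every point of Phi(l^k) is the k-th
    component of a Tate vector, hence an A-combination of those, so p(F) kills Phi(l^k) for all
    k. *)
Lemma eval_Frob_tate_char_poly (l : {poly F}) p : (1 < size l)%N -> gamma l != 0 ->
  is_tate_char_poly Phi iota l p -> eval_Frob Phi p = 0.
Proof.
move=> sl gl [r [e [A [[tate_e gen_e _] _ FA charA]]]].
apply: (drinfeld_kernel_eq0 sl gl) => k x lkx.
have ker_e i : act (eval_Frob Phi p) (e i k) = 0.
  have Fk j : act (Frob L) (e j k) = \sum_i act (Phi (A k i j)) (e i k).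
    exact: (congr1 (fun f => f k) (FA j)).
  have [lk_e _] := tate_e i.
  have := Cayley_Hamilton_act Fk i.
  rewrite -[char_poly _](subrK p) rmorphD skew_actD /=.
  by rewrite (eval_Frob_act_dvd (charA k) (lk_e k)) add0r.
have [y /gen_e[a _ ->] <-] := torsion_tate_module sl lkx.
rewrite /tate_comb raddf_sum big1 // => i _.
rewrite /= -eval_FrobC -skew_actM -rmorphM mulrC rmorphM skew_actM /= ker_e.
exact: raddf0.
Qed.

End DrinfeldTheory.

(** * Orders in a quadratic extension of F(T) *)

Section QuadraticOrders.
Variables (F E : fieldType) (k : {rmorphism {poly F} -> E}).
Implicit Types (a b d t n : {poly F}) (w z : E).

(** [t] and [n] stand for the trace and the norm of [w]. *)
Definition is_quadratic w t n := w ^+ 2 = k t * w - k n.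
Definition independent w := forall a b, k a + k b * w = 0 -> a = 0 /\ b = 0.
(** With denominators cleared: 1 and [w] generate [E] over the fraction field of A. *)
Definition spanning w :=
  forall z, exists d a b, d != 0 /\ k d * z = k a + k b * w.

Lemma independent_inj w : independent w -> injective k.
Proof.
move=> w_indep a b kab; apply/subr0_eq.
by have [] := w_indep (a - b) 0; rewrite // rmorph0 mul0r addr0 rmorphB kab subrr.
Qed.

Hypothesis k_inj : injective k.

Lemma k_eq0 a : (k a == 0) = (a == 0).
Proof. by rewrite -(rmorph0 k) (inj_eq k_inj). Qed.

(** Rational root argument: with z = a'/b' in lowest terms, clearing denominators in a monic
    equation makes b' divide a power of a', so b' is a unit. *)
Lemma integrally_closed z a b : b != 0 -> k b * z = k a ->
  integralOver k z -> exists c, z = k c.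
Proof.
move=> b0 def_z [p p_monic pz0].
have [g0 [b' [a' [def_b def_a co_ab]]]] : exists g, exists b' a',
    [/\ b = b' * g, a = a' * g & coprimep b' a'].
  exists (gcdp b a), (b %/ gcdp b a), (a %/ gcdp b a).
  by rewrite !divpK ?dvdp_gcdl ?dvdp_gcdr // coprimep_div_gcd // b0.
have g0' : g0 != 0 by apply: contraNneq b0 => g00; rewrite def_b g00 mulr0.
have b'0 : b' != 0 by apply: contraNneq b0 => b00; rewrite def_b b00 mul0r.
have {}def_z : k b' * z = k a'.
  apply: (mulIf (_ : k g0 != 0)); first by rewrite k_eq0.
  by rewrite mulrAC -!rmorphM -def_b -def_a.
have sum0 : \sum_(i < size p) p`_i * a' ^+ i * b' ^+ ((size p).-1 - i) = 0.
  apply: k_inj; rewrite rmorph0 rmorph_sum.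
  transitivity (k (b' ^+ (size p).-1) * (map_poly k p).[z]); last first.
    by rewrite (rootP pz0) mulr0.
  rewrite horner_coef size_map_poly_id0; last first.
    by rewrite (monicP p_monic) rmorph1 oner_neq0.
  rewrite mulr_sumr; apply: eq_bigr => i _; rewrite coef_map !rmorphM /=.
  have le_i : (i <= (size p).-1)%N.
    by rewrite -ltnS prednK // (leq_ltn_trans _ (ltn_ord i)).
  have bE : k (b' ^+ (size p).-1) * z ^+ i =
            k (a' ^+ i) * k (b' ^+ ((size p).-1 - i)).
    by rewrite -{1}(subnKC le_i) exprD rmorphM !rmorphXn -def_z exprMn mulrAC.
  by rewrite mulrCA bE mulrA.
have b'_dvd : b' %| a' ^+ (size p).-1.
  have sp : (0 < size p)%N by rewrite size_poly_gt0 monic_neq0.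
  move: sum0; have lp := monicP p_monic; rewrite lead_coefE in lp.
  case: (size p) sp lp => // m _ lp; rewrite big_ord_recr /= subnn lp mulr1 mul1r.
  move/eqP; rewrite addrC addr_eq0 => /eqP->; rewrite dvdpNr.
  apply: (big_ind (fun x => b' %| x)) => [|x y|i _]; [exact: dvdp0|exact: dvdp_add|].
  by rewrite dvdp_mull // dvdp_exp // subn_gt0.
have : b' %= 1.
  rewrite -size_poly_eq1 -dvdp1 -(Gauss_dvdpl _ (coprimep_expr (size p).-1 co_ab)) mul1r //.
rewrite eqp_sym => /eqpP[[c1 c2] /andP[/= c10 c20] c12].
have def_b' : b' = (c1 / c2)%:P.
  by rewrite -[b']scale1r -(mulVf c20) -scalerA -c12 scalerA mulrC alg_polyC.
exists ((c2 / c1) *: a'); apply: (mulfI (_ : k b' != 0)); first by rewrite k_eq0.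
rewrite def_z -rmorphM def_b' mul_polyC scalerA mulrA divfK // divff // scale1r //.
Qed.

Lemma integralOver_quadratic w t n : is_quadratic w t n -> integralOver k w.
Proof.
move=> wE; exists ('X^2 - (t *: 'X - n%:P)).
  rewrite monicE lead_coefDl ?lead_coefXn // size_polyN size_polyXn ltnS.
  rewrite (leq_trans (size_polyD _ _)) // geq_max size_polyN.
  rewrite (leq_trans (size_scale_leq _ _)) ?size_polyX //.
  by rewrite (leq_trans (size_polyC_leq1 _)).
apply/rootP; rewrite !rmorphB /= map_polyZ map_polyXn map_polyX map_polyC /=.
by rewrite !hornerE wE subrr.
Qed.

Section Conjugation.
Variables (w : E) (t n : {poly F}).
Hypotheses (wE : is_quadratic w t n) (w_indep : independent w).

(** Stands in for the nontrivial automorphism. Evaluating [p] uses only the quadratic equation of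
    [w], which k t - w satisfies too, so D p(z) and D p(z') have the same coordinates in (1, w) and
    in (1, k t - w); if p(z) = 0, independence makes them zero. *)
Lemma conjugate_root z z' d a b p : d != 0 ->
  k d * z = k a + k b * w -> k d * z' = k a + k b * (k t - w) ->
  root (map_poly k p) z -> root (map_poly k p) z'.
Proof.
move=> d0 zE z'E.
have [D [x [y [D0 pz pz']]]] : exists D x y, [/\ D != 0,
    k D * (map_poly k p).[z] = k x + k y * w
  & k D * (map_poly k p).[z'] = k x + k y * (k t - w)].
  elim/poly_ind: p => [|p c [D [x [y [D0 pz pz']]]]].
    by exists 1, 0, 0; rewrite oner_neq0 !rmorph0 !horner0 !mul0r !mulr0 !addr0.
  exists (D * d), (x * a - y * b * n + D * d * c), (x * b + y * a + y * b * t).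
  have mapE v : (map_poly k (p * 'X + c%:P)).[v] = (map_poly k p).[v] * v + k c.
    by rewrite rmorphD rmorphM /= map_polyX map_polyC /= !hornerE.
  rewrite mulf_neq0 // !mapE !rmorphD !rmorphN !rmorphM /=; split=> //.
    rewrite mulrDr mulrACA pz zE; move: wE; rewrite /is_quadratic => wE'.
    rewrite [LHS](_ : _ = k x * k a + (k x * k b + k y * k a) * w +
      k y * k b * w ^+ 2 + k D * k d * k c); last by ring.
    by rewrite wE'; ring.
  rewrite mulrDr mulrACA pz' z'E.
  rewrite [LHS](_ : _ = k x * k a + (k x * k b + k y * k a) * (k t - w) +
    k y * k b * (k t ^+ 2 - 2%:R * k t * w + w ^+ 2) + k D * k d * k c); last by ring.
  by rewrite wE; ring.
move=> /rootP pz0; apply/rootP/eqP.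
have [x0 y0] := w_indep (etrans (esym pz) (etrans (congr1 ( *%R _) pz0) (mulr0 _))).
move: pz'; rewrite x0 y0 rmorph0 mul0r addr0 => /eqP.
by rewrite mulf_eq0 k_eq0 (negPf D0).
Qed.

(** The trace and norm of [z] are integral, being the sum and product of [z] and its conjugate, and
    they are fractions of A, so they lie in A. The discriminants compare because d (z - z') = b (2 w
    - t). *)
Lemma integral_is_quadratic z d a b : d != 0 -> k d * z = k a + k b * w ->
  integralOver k z -> exists t' n', is_quadratic z t' n' /\
    d ^+ 2 * (t' ^+ 2 - 4%:R * n') = b ^+ 2 * (t ^+ 2 - 4%:R * n).
Proof.
move=> d0 zE z_int; have kd0 : k d != 0 by rewrite k_eq0.
pose z' := (k a + k b * (k t - w)) / k d.
have z'E : k d * z' = k a + k b * (k t - w) by rewrite mulrC divfK.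
have z'_int : integralOver k z'.
  by case: z_int => p p_monic pz; exists p => //; exact: conjugate_root zE z'E pz.
have trE : k d * (z + z') = k (2%:R * a + b * t).
  by rewrite mulrDr zE z'E rmorphD !rmorphM rmorph_nat; ring.
have nmE : k (d ^+ 2) * (z * z') = k (a ^+ 2 + a * b * t + b ^+ 2 * n).
  rewrite rmorphXn expr2 mulrACA zE z'E !(rmorphD, rmorphM, rmorphXn) /=.
  transitivity (k a ^+ 2 + k a * k b * k t + k b ^+ 2 * (k t * w - w ^+ 2)).
    by ring.
  by rewrite wE; ring.
have [t' t'E] := integrally_closed d0 trE (integral_add z_int z'_int).
have d20 : d ^+ 2 != 0 by rewrite expf_neq0.
have [n' n'E] := integrally_closed d20 nmE (integral_mul z_int z'_int).
exists t', n'; split; first by rewrite /is_quadratic -t'E -n'E; ring.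
move: trE nmE; rewrite t'E n'E -!rmorphM => /k_inj trE /k_inj nmE.
transitivity ((d * t') ^+ 2 - 4%:R * (d ^+ 2 * n')); first by ring.
by rewrite trE nmE; ring.
Qed.

End Conjugation.

(* Descent on the degree of the discriminant: if some integral z lies outside *)
(* A + A w, a Bezout combination of z and w has a smaller discriminant.       *)
Lemma maximal_order_basis w t n : is_quadratic w t n -> independent w ->
  spanning w -> t ^+ 2 - 4%:R * n != 0 -> exists o s m,
  [/\ is_quadratic o s m, independent o, s ^+ 2 - 4%:R * m != 0 &
      forall z, integralOver k z <-> exists a b, z = k a + k b * o].
Proof.
have [N] := ubnP (size (t ^+ 2 - 4%:R * n)).
elim: N => // N IHN in w t n *; rewrite ltnS => le_N wE w_indep w_span disc0.
have w_int := integralOver_quadratic wE.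
have [all_z|/existsNP[z /not_implyP[z_int z_out]]] :=
  pselect (forall z, integralOver k z -> exists a b, z = k a + k b * w).
  exists w, t, n; split=> // z; split; first exact: all_z.
  by move=> [a [b ->]]; apply: integral_add (integral_mul _ _) => //; exact: integral_id.
have [d [a [b [d0 zE]]]] := w_span z.
have [[/= x y] g_bez] := Bezoutp b d.
set g := x * b + y * d in g_bez.
have g_dvd_d : g %| d by rewrite (eqp_dvdl _ g_bez) dvdp_gcdr.
have g_dvd_b : g %| b by rewrite (eqp_dvdl _ g_bez) dvdp_gcdl.
have g0 : g != 0 by apply: contraNneq d0 => g00; move: g_dvd_d; rewrite g00 dvd0p.
set d' := d %/ g; have d'E : d = d' * g by rewrite divpK.
have d'0 : d' != 0 by apply: contraNneq d0 => d00; rewrite d'E d00 mul0r.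
(* By Bezout, the coordinate of [o] along [w] is g / d = 1 / d', so the discriminant gets divided by
   d'^2. *)
pose o := k x * z + k y * w.
have oE : k d * o = k (x * a) + k g * w.
  rewrite /o mulrDr mulrCA zE rmorphD !rmorphM /=; ring.
have o_int : integralOver k o.
  by apply: integral_add; apply: integral_mul => //; exact: integral_id.
have [s [m [oQ disc_o]]] := integral_is_quadratic wE w_indep d0 oE o_int.
have {}disc_o : d' ^+ 2 * (s ^+ 2 - 4%:R * m) = t ^+ 2 - 4%:R * n.
  by apply: (mulIf (expf_neq0 2 g0)); rewrite mulrAC -exprMn -d'E disc_o mulrC.
have disc_o0 : s ^+ 2 - 4%:R * m != 0.
  by apply: contraNneq disc0 => disc_o0; rewrite -disc_o disc_o0 mulr0.
apply: (IHN o s m) => // [|c e coE|u].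
- apply: leq_trans le_N; rewrite -disc_o size_mul ?expf_neq0 //.
  rewrite -(prednK (_ : (0 < size (d' ^+ 2))%N)) ?size_poly_gt0 ?expf_neq0 //.
  rewrite addSn /= -[X in (X < _)%N]add0n ltn_add2r size_exp muln_gt0 andbT.
  rewrite -subn1 subn_gt0; apply: contraT; rewrite -leqNgt => sd'.
  (* If d' were constant, [d] would divide [b] and z - (b / d) w would be an integral fraction,
     hence in A; then [z] would lie in A + A w. *)
  case: z_out; have {sd'} d'1 : d' %| 1.
    by rewrite dvdp1 eqn_leq sd' size_poly_gt0.
  have d_b : d %| b.
    by rewrite d'E -[b](divpK g_dvd_b) dvdp_mul // (dvdp_trans d'1) ?dvd1p.
  have kd0 : k d != 0 by rewrite k_eq0.
  have bE : k b = k (b %/ d) * k d by rewrite -rmorphM divpK.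
  have [c cE] : exists c, z - k (b %/ d) * w = k c.
    apply: (integrally_closed d0 (a := a)).
      by rewrite mulrBr zE bE mulrA (mulrC (k d)) addrK.
    by apply: integral_sub => //; apply: integral_mul => //; exact: integral_id.
  by exists c, (b %/ d); rewrite -cE subrK.
- have: k (c * d + e * (x * a)) + k (e * g) * w = 0.
    rewrite rmorphD !(rmorphM _ e) -addrA -mulrA -mulrDr -oE.
    by rewrite rmorphM mulrCA mulrC -mulrDr coE mulr0.
  move=> /w_indep[c0 /eqP]; rewrite mulf_eq0 (negPf g0) orbF => /eqP e0.
  move: c0; rewrite e0 mul0r addr0 => /eqP; rewrite mulf_eq0 (negPf d0) orbF.
  by move=> /eqP.
- have [e [u0 [u1 [e0 uE]]]] := w_span u.
  exists (e * g), (u0 * g - u1 * (x * a)), (u1 * d); rewrite mulf_neq0 //; split=> //.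
  rewrite rmorphM mulrAC uE mulrDl rmorphB !(rmorphM _ u1) !(rmorphM _ u0).
  by rewrite -[k u1 * k d * o]mulrA oE; ring.
Qed.

End QuadraticOrders.

(** * Traces and discriminants under a change of basis *)

Section BasisChange.
Variables (A : comNzRingType) (E : comNzRingType) (k : {rmorphism A -> E}) (r : nat).
Implicit Types (e : 'I_r -> E).

Definition free_family e :=
  forall a : 'I_r -> A, \sum_i k (a i) * e i = 0 -> forall i, a i = 0.

Definition is_mulmx_of e (x : E) (M : 'M[A]_r) :=
  forall j, x * e j = \sum_i k (M i j) * e i.

Definition trace_in e (x : E) (t : A) := exists2 M, is_mulmx_of e x M & t = \tr M.

Lemma mulmx_of_unique e (e_free : free_family e) (B C : 'M[A]_r) :
  (forall j, \sum_i k (B i j) * e i = \sum_i k (C i j) * e i) -> B = C.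
Proof.
move=> eBC; apply/matrixP => i j; apply/subr0_eq.
apply: (e_free (fun i => B i j - C i j)).
under eq_bigr do rewrite rmorphB mulrBl.
by rewrite sumrB eBC subrr.
Qed.

Lemma comb_mulmx e e' (B C : 'M[A]_r) :
  (forall j, e' j = \sum_i k (B i j) * e i) ->
  forall j, \sum_i k (C i j) * e' i = \sum_i k ((B *m C) i j) * e i.
Proof.
move=> e'E j; under eq_bigr do rewrite e'E mulr_sumr.
rewrite exchange_big; apply: eq_bigr => i _ /=.
rewrite mxE rmorph_sum mulr_suml; apply: eq_bigr => l _.
by rewrite rmorphM mulrA [k (C l j) * _]mulrC.
Qed.

Variables (e e' : 'I_r -> E) (U V : 'M[A]_r).
Hypothesis e_free : free_family e.
Hypotheses (e'E : forall j, e' j = \sum_i k (U i j) * e i).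
Hypotheses (eE : forall j, e j = \sum_i k (V i j) * e' i).

Lemma basis_change_inv : U *m V = 1%:M.
Proof.
apply: (mulmx_of_unique e_free) => j; rewrite -(comb_mulmx _ e'E) -eE.
rewrite (bigD1 j) //= !mxE eqxx rmorph1 mul1r big1 ?addr0 // => i /negPf ij.
by rewrite mxE ij rmorph0 mul0r.
Qed.

(** The two matrices of multiplication by [x] are conjugate under [U]. *)
Lemma trace_basis_change x t t' : trace_in e x t -> trace_in e' x t' -> t = t'.
Proof.
move=> [M xM ->] [M' xM' ->].
have UM : M *m U = U *m M'.
  apply: (mulmx_of_unique e_free) => j.
  rewrite -(comb_mulmx _ e'E) -(comb_mulmx _ (B := M) (e' := fun j => x * e j)) //.
  rewrite -xM' e'E mulr_sumr; apply: eq_bigr => i _; exact: mulrCA.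
have VU : V *m U = 1%:M := mulmx1C basis_change_inv.
rewrite -[M]mulmx1 -basis_change_inv mulmxA UM mxtrace_mulC mulmxA VU.
by rewrite mul1mx.
Qed.

(** Bilinearity of the trace form. As traces are given by a relation, it is established on matrices
    of multiplication. *)
Lemma gram_basis_change (T T' : 'M[A]_r) :
  (forall i j, trace_in e (e i * e j) (T i j)) ->
  (forall i j, trace_in e' (e' i * e' j) (T' i j)) -> T' = U^T *m T *m U.
Proof.
move=> TE T'E.
have /choice[M ME] : forall ij : 'I_r * 'I_r, exists M, is_mulmx_of e (e ij.1 * e ij.2) M
   /\ T ij.1 ij.2 = \tr M.
  by case=> i j; have [M] := TE i j; exists M.
apply/matrixP => i j.
(* The matrix in [e] of multiplication by [e' i * e' j], both factors being expanded over [e]. *)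
pose N := \sum_a \sum_b (U a i * U b j) *: M (a, b).
have NE : trace_in e (e' i * e' j) (\tr N).
  exists N => // l; rewrite !e'E mulr_suml mulr_suml.
  transitivity (\sum_a \sum_b k (U a i * U b j) * (e a * e b * e l)).
    apply: eq_bigr => a _; rewrite mulr_sumr mulr_suml; apply: eq_bigr => b _.
    by rewrite rmorphM; ring.
  transitivity (\sum_a \sum_b \sum_c k ((U a i * U b j) * M (a, b) c l) * e c).
    apply: eq_bigr => a _; apply: eq_bigr => b _.
    have [/(_ l) /= -> _] := ME (a, b); rewrite mulr_sumr; apply: eq_bigr => c _.
    by rewrite (rmorphM _ _ (M _ _ _)) mulrA.
  under eq_bigr do rewrite exchange_big /=.
  rewrite exchange_big /=; apply: eq_bigr => c _.
  rewrite summxE rmorph_sum mulr_suml; apply: eq_bigr => a _.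
  rewrite summxE rmorph_sum mulr_suml; apply: eq_bigr => b _.
  by rewrite mxE.
rewrite -(trace_basis_change NE (T'E i j)) mxE.
transitivity (\sum_a \sum_b U a i * U b j * T a b).
  rewrite /N linear_sum; apply: eq_bigr => a _; rewrite linear_sum /=.
  by apply: eq_bigr => b _; rewrite mxtraceZ; have [_ /= <-] := ME (a, b).
under [RHS]eq_bigr do rewrite mxE mulr_suml.
rewrite exchange_big /=; apply: eq_bigr => a _; apply: eq_bigr => b _.
by rewrite mxE mulrAC.
Qed.

Lemma disc_basis_change (T T' : 'M[A]_r) :
  (forall i j, trace_in e (e i * e j) (T i j)) ->
  (forall i j, trace_in e' (e' i * e' j) (T' i j)) ->
  \det T' = \det U ^+ 2 * \det T /\ \det U * \det V = 1.
Proof.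
move=> TE T'E; rewrite (gram_basis_change TE T'E) !det_mulmx det_tr; split.
  by rewrite mulrAC expr2.
by rewrite -det_mulmx basis_change_inv det1.
Qed.

End BasisChange.

(** * The order of a given discriminant *)

Section OrderOfDiscriminant.
Variables (F : finFieldType) (L : fieldExtType F).
Variables (gamma : {lrmorphism {poly F} -> L}) (Phi : drinfeld_module2 gamma).
Local Notation k := (KFrob_const Phi).
Local Notation A := {poly F}.
Local Open Scope classical_set_scope.

Definition order_gen (w : KFrob Phi) : set (KFrob Phi) :=
  [set z | exists a b, z = k a + k b * w].

Definition pair_basis (w : KFrob Phi) : 'I_2 -> KFrob Phi :=
  fun i => if i == 0 then 1 else w.

Lemma pair_basisE w (a : 'I_2 -> A) :
  \sum_i k (a i) * pair_basis w i = k (a 0) + k (a 1) * w.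
Proof. by rewrite big_ord_recl big_ord1 /= mulr1; congr (_ + k (a _) * _); apply: val_inj. Qed.

Lemma order_gen_basis w : independent k w -> is_order_basis (order_gen w) (pair_basis w).
Proof.
move=> w_indep; split=> [z|a].
  split=> [[a [b ->]]|[a ->]]; last by rewrite pair_basisE; exists (a 0), (a 1).
  by exists (fun i => if i == 0 then a else b); rewrite pair_basisE.
rewrite pair_basisE => /w_indep[a0 a1] i.
by case: i => -[|[|//]] lt_i; [rewrite -[RHS]a0|rewrite -[RHS]a1]; congr (a _); apply: val_inj.
Qed.

(** In the basis (1, w) the traces of 1, w and w^2 are 2, t and t^2 - 2 n. *)
Lemma order_gen_discriminant w t n : is_quadratic k w t n -> independent k w ->
  has_discriminant (order_gen w) (t ^+ 2 - 4%:R * n).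
Proof.
move=> wE w_indep; exists (pair_basis w); first exact: order_gen_basis.
pose mk (a b c d : A) : 'M[A]_2 := \matrix_(i, j)
  if i == 0 then (if j == 0 then a else b) else (if j == 0 then c else d).
have tr_mk a b c d : \tr (mk a b c d) = a + d.
  by rewrite /mxtrace big_ord_recl big_ord1 !mxE.
have tr_w x a b c d : x = k a + k c * w -> x * w = k b + k d * w ->
    is_trace (pair_basis w) x (a + d).
  move=> xE xwE; exists (mk a b c d); last by rewrite tr_mk.
  move=> j; rewrite pair_basisE !mxE /=; case: j => -[|[|//]] lt_j; rewrite /pair_basis /=.
    by rewrite mulr1.
  by [].
exists (mk 2%:R t t (t ^+ 2 - 2%:R * n)).
  move=> i j; rewrite !mxE /pair_basis.
  have tr1 : is_trace (pair_basis w) w t.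
    rewrite -[t]add0r; apply: (tr_w _ _ (- n) 1); first by rewrite rmorph0 rmorph1 add0r mul1r.
    by rewrite -expr2 wE rmorphN addrC.
  case: (i == 0); case: (j == 0); rewrite ?mulr1 ?mul1r //.
    by apply: (tr_w _ 1 0 0 1); rewrite ?rmorph0 ?rmorph1 ?mul1r ?mul0r ?addr0 ?add0r.
  have -> : t ^+ 2 - 2%:R * n = - n + (t ^+ 2 - n) by ring.
  apply: (tr_w _ _ (- (t * n)) t); first by rewrite -expr2 wE rmorphN addrC.
  rewrite -expr2 wE mulrBl -mulrA -expr2 wE rmorphN rmorphB !rmorphM; ring.
rewrite (expand_det_row _ 0) big_ord_recl big_ord1 /cofactor !det_mx11 !mxE /=.
ring.
Qed.

(** Two A-bases of one order differ by an invertible matrix, whose determinant enters squared. *)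
Lemma disc_unique (O : set (KFrob Phi)) e0 (T : 'M[A]_2) D :
  is_order_basis O e0 -> (forall i j, is_trace e0 (e0 i * e0 j) (T i j)) ->
  has_discriminant O D -> exists u v, u * v = 1 /\ D = u ^+ 2 * \det T.
Proof.
move=> [O_e0 e0_free] TE [e' [O_e' e'_free] [T' T'E ->]].
have in_O e : (forall z, O z <-> exists a : 'I_2 -> A, z = \sum_i k (a i) * e i) ->
    forall j, O (e j).
  move=> O_e j; apply/O_e; exists (fun i => (i == j)%:R).
  rewrite (bigD1 j) //= eqxx rmorph1 mul1r big1 ?addr0 // => i /negPf->.
  by rewrite rmorph0 mul0r.
have span e e1 : (forall z, O z <-> exists a : 'I_2 -> A, z = \sum_i k (a i) * e i) ->
    (forall j, O (e1 j)) ->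
    exists U : 'M[A]_2, forall j, e1 j = \sum_i k (U i j) * e i.
  move=> O_e O_e1; have /choice[a aE] : forall j, exists a : 'I_2 -> A,
      e1 j = \sum_i k (a i) * e i by move=> j; apply/O_e.
  by exists (\matrix_(i, j) a j i) => j; under eq_bigr do rewrite mxE.
have [U UE] := span _ _ O_e0 (in_O _ O_e').
have [V VE] := span _ _ O_e' (in_O _ O_e0).
have [-> UV] := disc_basis_change e0_free UE VE TE T'E.
by exists (\det U), (\det V).
Qed.

Lemma order_gen_subset w x y : order_gen (k x + k y * w) `<=` order_gen w.
Proof.
move=> _ [a [b ->]]; exists (a + b * x), (b * y).
by rewrite rmorphD !rmorphM; ring.
Qed.

(** Any order is A + A g o, with (1, o) a basis of the maximal order, and has discriminant g^2
    disc(o) up to the square of a unit. Both A + A w and the order picked by [xget] have this form,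
    with the same discriminant. *)
Lemma order_of_discriminantE w t n : is_quadratic k w t n -> independent k w ->
  spanning k w -> t ^+ 2 - 4%:R * n != 0 ->
  order_of_discriminant Phi (t ^+ 2 - 4%:R * n) = order_gen w.
Proof.
move=> wE w_indep w_span disc0; have k_inj := independent_inj w_indep.
have [o [s [m [oE o_indep disc_o0 o_max]]]] :=
  maximal_order_basis k_inj wE w_indep w_span disc0.
have orderE g : [set z | exists x, exists2 y, maximal_order Phi y &
    z = k x + k g * y] = order_gen (k g * o).
  apply/seteqP; split=> z /=.
    move=> [x [y /o_max[b [c ->]] ->]]; exists (x + g * b), c.
    by rewrite rmorphD !rmorphM; ring.
  move=> [x [y ->]]; exists x, (k y * o); last by ring.
  by apply/o_max; exists 0, y; rewrite rmorph0 add0r.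
set D := _ - _.
have order_disc O : is_order O -> has_discriminant O D -> exists g u v,
    [/\ O = order_gen (k g * o), u * v = 1 &
        D = (u * g) ^+ 2 * (s ^+ 2 - 4%:R * m)].
  move=> [g g0 ->]; rewrite orderE => O_D; exists g.
  have goE : is_quadratic k (k g * o) (g * s) (g ^+ 2 * m).
    by rewrite /is_quadratic exprMn oE !rmorphM; ring.
  have go_indep : independent k (k g * o).
    move=> a b; rewrite mulrA -rmorphM => /o_indep[-> /eqP].
    by rewrite mulf_eq0 (negPf g0) orbF => /eqP.
  have := order_gen_discriminant goE go_indep.
  move=> [e O_e [T TE disc_T]].
  have [u [v [uv ->]]] := disc_unique O_e TE O_D.
  by exists u, v; split=> //; rewrite -disc_T; ring.
have w_order : is_order (order_gen w).
  (* [w] is integral, so w = a + g o, and [g] is nonzero because [w] is not in A. *)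
  have /o_max[a [g wE']] := integralOver_quadratic wE.
  have g0 : g != 0.
    apply/eqP => g0; have [|_ /eqP] := w_indep (- a) 1.
      by rewrite wE' g0 rmorph0 mul0r addr0 rmorphN rmorph1 mul1r addNr.
    by rewrite oner_eq0.
  exists g => //; rewrite orderE wE'; apply/seteqP; split.
    by rewrite -[X in k a + X]mul1r -(rmorph1 k); exact: order_gen_subset.
  have {1}-> : k g * o = k (- a) + k 1 * (k a + k g * o).
    by rewrite rmorphN rmorph1 mul1r addrA addNr add0r.
  exact: order_gen_subset.
have w_disc := order_gen_discriminant wE w_indep.
have [g [u [v [w_g uv D_g]]]] := order_disc _ w_order w_disc.
rewrite /order_of_discriminant; case: xgetP => [O _ [/= O_order O_disc]|]; last first.
  by move/(_ (order_gen w)) => /=; case; split.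
have [g' [u' [v' [-> uv' D_g']]]] := order_disc _ O_order O_disc.
(* Cancelling disc(o) leaves (u g)^2 = (u' g')^2, so [g] and [g'] agree up to a unit and generate
   the same order. *)
rewrite w_g; move: D_g'; rewrite D_g => /(mulIf disc_o0)/eqP; rewrite eqf_sqr => ug.
have unit_sub x y p q (r : A) : p * q = 1 -> p * x = r * y ->
    order_gen (k x * o) `<=` order_gen (k y * o).
  move=> pq pxry; have -> : k x * o = k 0 + k (q * r) * (k y * o).
    have -> : x = q * r * y by rewrite -mulrA -pxry mulrCA mulrA pq mul1r.
    by rewrite rmorph0 add0r rmorphM mulrA.
  exact: order_gen_subset.
apply/seteqP; split; case/orP: ug => /eqP ug.
- exact: unit_sub uv' (esym ug).
- by apply: (unit_sub _ _ _ _ (- u) uv'); rewrite mulNr ug opprK.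
- exact: unit_sub uv ug.
- by apply: (unit_sub _ _ _ _ (- u') uv); rewrite mulNr.
Qed.

End OrderOfDiscriminant.

(** * The field K(F) *)

Lemma fraction_ex (R : idomainType) (z : {fraction R}) :
  exists x y : R, y != 0 /\ z = FracField.tofrac x / FracField.tofrac y.
Proof.
elim/quotW: z => r; exists (frac r).1, (frac r).2; have d0 := denom_ratioP r.
split=> //; apply: (canRL (mulfK _)); first by rewrite tofrac_eq0.
unlock FracField.tofrac; rewrite -[LHS]FracField.pi_mul.
apply/eqmodP; rewrite /= /FracField.equivf /FracField.mulf.
by rewrite !numden_Ratio ?mulf_neq0 ?oner_neq0 // !mulr1 mulrC.
Qed.

Section FrobeniusFieldTheory.
Variables (F : finFieldType) (L : fieldExtType F).
Variables (gamma : {lrmorphism {poly F} -> L}) (Phi : drinfeld_module2 gamma).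
Local Notation k := (KFrob_const Phi).
Local Notation A := {poly F}.

Fact Frob_in_AFrob : Frob L \in in_AFrob Phi.
Proof. by apply/in_AFrobP; exists 'X; rewrite eval_FrobX. Qed.

Definition AFrobenius : AFrob Phi := MkAFrob Frob_in_AFrob.
Definition KFrobenius : KFrob Phi := FracField.tofrac AFrobenius.
Local Notation f := KFrobenius.

Lemma KFrob_const_inj : injective k.
Proof.
move=> a b /eqP; rewrite tofrac_eq => /eqP/(congr1 val)/= ab.
by apply/subr0_eq/eqP; rewrite -(drinfeld_eq0 Phi) rmorphB subr_eq0; apply/eqP.
Qed.

Lemma KFrob_const_Frob_eq (e : A) : f = k e -> Frob L = Phi e.
Proof. by move=> /eqP; rewrite tofrac_eq => /eqP/(congr1 val). Qed.

Variables (c N : A).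
Hypothesis Frob_root : eval_Frob Phi ('X^2 - c%:P * 'X + N%:P) = 0.

Lemma AFrobenius_quadratic :
  AFrobenius ^+ 2 = AFrob_const Phi c * AFrobenius - AFrob_const Phi N.
Proof.
apply: val_inj; apply/eqP; rewrite rmorphB !rmorphM /= -subr_eq0 opprB addrA.
rewrite -Frob_root rmorphD rmorphB !rmorphM /= eval_FrobX !eval_FrobC.
by rewrite addrAC.
Qed.

Lemma AFrob_lin (x : AFrob Phi) :
  exists a b, x = AFrob_const Phi a + AFrob_const Phi b * AFrobenius.
Proof.
have [p def_x] := in_AFrobP Phi _ (valP x).
elim/poly_ind: p x def_x => [|p a IHp] x def_x.
  by exists 0, 0; apply: val_inj; rewrite def_x !rmorph0 mul0r addr0.
have y_in : eval_Frob Phi p \in in_AFrob Phi by apply/in_AFrobP; exists p.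
have [b [d yE]] := IHp (MkAFrob y_in) erefl.
have -> : x = MkAFrob y_in * AFrobenius + AFrob_const Phi a.
  apply: val_inj; rewrite def_x rmorphD rmorphM /= eval_FrobX eval_FrobC.
  by [].
exists (a - d * N), (b + d * c); rewrite yE.
transitivity (AFrob_const Phi b * AFrobenius +
  AFrob_const Phi d * AFrobenius ^+ 2 + AFrob_const Phi a); first by ring.
by rewrite AFrobenius_quadratic rmorphB rmorphD !rmorphM; ring.
Qed.

Lemma KFrobenius_quadratic : is_quadratic k f c N.
Proof.
rewrite /is_quadratic /f -tofracXn AFrobenius_quadratic tofracB tofracM //.
Qed.

(** A relation a + b F = 0 with b nonzero would make F an integral fraction, hence an element of
    A. *)
Lemma KFrobenius_independent : (forall e, Frob L <> Phi e) -> independent k f.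
Proof.
move=> F_out a b abf0; have [b0|b0] := eqVneq b 0.
  move: abf0; rewrite b0 rmorph0 mul0r addr0 => /eqP.
  by rewrite (k_eq0 KFrob_const_inj) => /eqP.
have bf : k b * f = k (- a).
  by apply/eqP; rewrite rmorphN -addr_eq0 addrC abf0.
have [e fe] := integrally_closed KFrob_const_inj b0 bf
  (integralOver_quadratic KFrobenius_quadratic).
by case: (F_out e); apply: KFrob_const_Frob_eq.
Qed.

(** A fraction x / y is rationalised by the conjugate [y'] of [y], in which F becomes c - F; the
    product y y' is the norm [nm], in A. *)
Lemma KFrobenius_spanning : independent k f -> spanning k f.
Proof.
move=> f_indep z; have [x [y [y0 ->]]] := fraction_ex z.
have [a [b yE]] := AFrob_lin y.
pose y' := AFrob_const Phi a + AFrob_const Phi b * (AFrob_const Phi c - AFrobenius).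
pose nm := a ^+ 2 + a * b * c + b ^+ 2 * N.
have yy' : y * y' = AFrob_const Phi nm.
  rewrite yE /y' /nm.
  transitivity (AFrob_const Phi a ^+ 2 +
    AFrob_const Phi a * AFrob_const Phi b * AFrob_const Phi c +
    AFrob_const Phi b ^+ 2 * (AFrob_const Phi c * AFrobenius - AFrobenius ^+ 2)).
    by ring.
  by rewrite AFrobenius_quadratic !rmorphD !rmorphM; ring.
have y'0 : y' != 0.
  apply: contraNneq y0 => /(congr1 (@FracField.tofrac _)).
  rewrite tofrac0 tofracD tofracM tofracB => y'0.
  have [|a0 /eqP] := f_indep (a + b * c) (- b).
    rewrite -{}[RHS]y'0 rmorphD rmorphM rmorphN /=; ring.
  rewrite oppr_eq0 => /eqP b0; move: a0; rewrite b0 mul0r addr0 => a0.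
  by rewrite yE a0 b0 !rmorph0 mul0r addr0.
have nm0 : nm != 0.
  have : y * y' != 0 by rewrite mulf_neq0.
  by rewrite yy'; apply: contraNneq => ->; rewrite rmorph0.
have [u [v xE]] := AFrob_lin (x * y').
exists nm, u, v; split=> //.
transitivity (FracField.tofrac (x * y')); last by rewrite xE tofracD tofracM.
rewrite [X in X * _](_ : _ = FracField.tofrac (y * y')); last by rewrite yy'.
by rewrite !tofracM mulrC -mulrA mulKf ?tofrac_eq0.
Qed.

End FrobeniusFieldTheory.

(** * Consequences of ordinarity *)

Section FrobeniusOrdinary.
Variables (F : finFieldType) (L : fieldExtType F).
Variables (gamma : {lrmorphism {poly F} -> L}) (Phi : drinfeld_module2 gamma).
Variables (M : closedFieldType) (iota : {rmorphism L -> M}).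
Local Notation act := (skew_act iota).
Local Notation k := (KFrob_const Phi).

(** Powers of F act as powers of x and have trivial kernel, whereas [Phi a] kills the P-division
    points. *)
Lemma ordinary_Frob_neq (P a : {poly F}) i :
  ordinary Phi iota P -> P %| a -> Frob L ^+ i <> Phi a.
Proof.
move=> P_ord P_a Fa; apply: P_ord; apply/seteqP; split=> x.
  move=> /(torsion_dvd P_a); rewrite /torsion /= -Fa /Frob -exprM skew_act_tauX.
  by move=> /eqP; rewrite expf_eq0 => /andP[_ /eqP].
by move=> ->; exact: raddf0.
Qed.

(** F has constant coefficient 0, so F = Phi_e would force gamma(e) = 0, that is P | e. *)
Lemma ordinary_Frob_notin (P : {poly F}) : (forall a, gamma a = 0 <-> P %| a) ->
  ordinary Phi iota P -> forall e, Frob L <> Phi e.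
Proof.
move=> gamma_P P_ord e Fe; apply: (ordinary_Frob_neq (i := 1) P_ord _ Fe).
apply/gamma_P; rewrite -(drinfeld_const Phi) -Fe coef_tauXn.
by rewrite eq_sym -leqn0 leqNgt adim_gt0.
Qed.

Lemma residue_codegree_gt0 : (0 < residue_codegree gamma)%N.
Proof. by rewrite divn_gt0 ?adim_gt0 // dimvS // subvf. Qed.

(** If the discriminant vanishes, (2 F - c)^2 = 0 and independence gives c = 0, in characteristic 2
    as well; then F^2 = - mu P^m, against ordinarity. *)
Lemma Frob_discriminant_neq0 (P c : {poly F}) (mu : F) m : (0 < m)%N ->
  (forall e, Frob L <> Phi e) -> ordinary Phi iota P ->
  eval_Frob Phi ('X^2 - c%:P * 'X + (mu *: P ^+ m)%:P) = 0 ->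
  c ^+ 2 - 4%:R * (mu *: P ^+ m) != 0.
Proof.
move=> m_gt0 F_out P_ord F_root; apply/eqP; set N := mu *: P ^+ m => disc0.
have f_indep := KFrobenius_independent F_root F_out.
have fE := KFrobenius_quadratic F_root.
set f := KFrobenius Phi in f_indep fE.
have two_f : (2%:R * f - k c) ^+ 2 = 0.
  transitivity (4%:R * f ^+ 2 - 4%:R * k c * f + k c ^+ 2); first by ring.
  have /eqP : k (c ^+ 2 - 4%:R * N) = 0 by rewrite disc0 rmorph0.
  rewrite rmorphB rmorphXn rmorphM rmorph_nat subr_eq0 => /eqP cN.
  rewrite cN fE; ring.
have [|c0 _] := f_indep (- c) 2%:R.
  rewrite rmorphN rmorph_nat addrC.
  by move/eqP: two_f; rewrite expf_eq0 => /andP[_ /eqP].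
have {}c0 : c = 0 by rewrite -[c]opprK c0 oppr0.
apply: (ordinary_Frob_neq (i := 2) (a := - N) P_ord).
  by rewrite dvdpNr /N -mul_polyC dvdp_mull // -(prednK m_gt0) exprS dvdp_mulIl.
apply/eqP; rewrite rmorphN -addr_eq0; apply/eqP.
rewrite -F_root c0 polyC0 mul0r subr0 rmorphD rmorphXn /=.
by rewrite eval_FrobX eval_FrobC.
Qed.

End FrobeniusOrdinary.

(** * Rational torsion and divisibility of F - 1 *)

Section RationalTorsion.
Variables (F : finFieldType) (L : fieldExtType F).
Variables (gamma : {lrmorphism {poly F} -> L}) (Phi : drinfeld_module2 gamma).
Variables (M : closedFieldType) (iota : {rmorphism L -> M}).
Local Notation act := (skew_act iota).
Local Notation k := (KFrob_const Phi).
Local Open Scope classical_set_scope.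

(** X^(q^n) - X already splits over L, with the elements of L as its roots. *)
Lemma mem_range_Frob x : range iota x <-> act (Frob L) x = x.
Proof.
rewrite /Frob skew_act_tauX; split=> [[y _ <-]|xq].
  by rewrite -rmorphXn; congr (iota _); exact: frobq_dim.
pose L' : finFieldType := FinFieldExtType L.
have card_L' : #|L'| = (#|F| ^ \dim {:L})%N.
  have <- := @card_vspacef F L' (Vector.class L).
  exact: (@card_vspace F L' (Vector.class L)).
have : root (map_poly iota ('X^#|L'| - 'X : {poly L'})) x.
  by rewrite rmorphB /= map_polyXn map_polyX rootE !hornerE card_L' xq subrr.
rewrite finField_genPoly rmorph_prod /= rootE horner_prod prodf_seq_eq0 => /hasP[y _].
rewrite rmorphB /= map_polyX map_polyC !hornerE subr_eq0 => /eqP->.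
by exists y.
Qed.

(** Rationality of Phi(rho) means that F - 1 vanishes on the kernel of [Phi rho], which is separable
    because [gamma rho] is nonzero. *)
Lemma torsion_rational_divides (rho : {poly F}) : gamma rho != 0 ->
  (torsion Phi iota rho `<=` range iota) <->
  exists2 u, endomorphisms Phi u & Frob L - 1 = u * Phi rho.
Proof.
move=> rho0; split=> [rat|[u u_end uE] x rho_x]; last first.
  apply/mem_range_Frob/subr0_eq; rewrite -[X in _ - X](skew_act1 iota) -skew_actB uE.
  by rewrite skew_actM (rho_x : act _ _ = 0); exact: raddf0.
have [|x rho_x|u uE] := @skew_kernel_sub _ _ _ iota (Phi rho) (Frob L - 1).
- by rewrite drinfeld_const.
- by rewrite skew_actB skew_act1; apply/eqP; rewrite subr_eq0; apply/eqP/mem_range_Frob/rat.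
(* The quotient [u] inherits commutation with [Phi a] from F - 1, by cancelling [Phi rho] on the
   right. *)
exists u => // a; apply: (@skew_mulIf _ _ (Phi rho)).
  by apply: contraNneq rho0 => Phi_rho0; rewrite -(drinfeld_const Phi) Phi_rho0 coef0.
rewrite -mulrA -rmorphM mulrC rmorphM mulrA -uE -[RHS]mulrA -uE.
by rewrite mulrBl mulrBr Frob_central mul1r mulr1.
Qed.

(** If w = x / b with x = b u in L{tau}, then b (F - 1) = x Phi_rho = b u Phi_rho, and [b] cancels.
    Conversely a + b w is realised by Phi_a + Phi_b u. *)
Lemma order_gen_endomorphisms (rho : {poly F}) : rho != 0 ->
  order_gen ((KFrobenius Phi - 1) / k rho) `<=` endomorphisms_in_KFrob Phi <->
  exists2 u, endomorphisms Phi u & Frob L - 1 = u * Phi rho.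
Proof.
move=> rho0; set w := _ / _; have krho0 : k rho != 0.
  by rewrite (k_eq0 (@KFrob_const_inj _ _ _ Phi)).
split=> [sub|[u u_end uE] _ [a [b ->]]].
  have [|u [x [b [u_end b0 xE wE]]]] := sub w.
    by exists 0, 1; rewrite rmorph0 rmorph1 add0r mul1r.
  exists u => //.
  have bF : b * (AFrobenius Phi - 1) = x * AFrob_const Phi rho.
    apply/eqP; rewrite mulrC -tofrac_eq !tofracM tofracB tofrac1; apply/eqP.
    have fb0 : FracField.tofrac b != 0 by rewrite tofrac_eq0.
    rewrite -[FracField.tofrac x](divfK fb0) -wE mulrAC.
    by rewrite [X in _ = X * _](divfK krho0).
  apply: (@skew_mulfI _ _ (AFrob_val b)).
    by apply: contraNneq b0 => b0; apply/eqP/val_inj.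
  by rewrite mulrA -xE; exact: (congr1 val bF).
(* The fraction used is (rho a + b (F - 1)) / rho. *)
exists (Phi a + Phi b * u), (AFrob_const Phi (rho * a) +
  AFrob_const Phi b * (AFrobenius Phi - 1)), (AFrob_const Phi rho); split.
- move=> d; rewrite mulrDl mulrDr -mulrA u_end !mulrA.
  by rewrite (drinfeldC _ d a) (drinfeldC _ d b).
- by rewrite -(tofrac_eq0 (AFrob_const Phi rho)).
- rewrite [RHS]mulrDr [in RHS]mulrA /= -(drinfeldC _ b) -mulrA -u_end -uE.
  by congr (_ + _); exact: rmorphM.
- apply: (mulIf krho0); rewrite [RHS]divfK // tofracD tofracM tofracB tofrac1.
  by rewrite mulrDl -[k b * w * _]mulrA [w * _]divfK // -rmorphM mulrC.
Qed.

End RationalTorsion.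

(** * From F to (F - 1) / rho, and the conclusion *)

(** c - 2 and 1 - c + N are the trace and norm of f - 1; division by [s] divides them by s and
    s^2. *)
Lemma affine_change_quadratic (F E : fieldType) (k : {rmorphism {poly F} -> E})
    (f : E) (c N s t n : {poly F}) : s != 0 -> is_quadratic k f c N ->
  independent k f -> spanning k f ->
  c - 2%:R = t * s -> 1 - c + N = n * s ^+ 2 ->
  [/\ is_quadratic k ((f - 1) / k s) t n, independent k ((f - 1) / k s) &
      spanning k ((f - 1) / k s)].
Proof.
move=> s0 fE f_indep f_span tE nE; have k_inj := independent_inj f_indep.
have ks0 : k s != 0 by rewrite k_eq0.
have swE : k s * ((f - 1) / k s) = f - 1 by rewrite mulrC divfK.
set w := _ / _ in swE *; split=> [|a b abw|z].
- apply: (mulIf (expf_neq0 2 ks0)); rewrite -exprMn mulrC swE.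
  have -> : (k t * w - k n) * k s ^+ 2 =
    k (t * s) * (k s * w) - k (n * s ^+ 2).
    by rewrite !rmorphM; ring.
  rewrite -tE -nE swE !rmorphD !rmorphN rmorph1 rmorph_nat.
  transitivity (f ^+ 2 - 2%:R * f + 1); first by ring.
  by rewrite fE; ring.
- have [|sab b0] := f_indep (s * a - b) b.
    rewrite rmorphB rmorphM.
    transitivity (k s * (k a + k b * w)); last by rewrite abw mulr0.
    rewrite mulrDr mulrCA swE; ring.
  split=> //; move: sab; rewrite b0 subr0 => /eqP.
  by rewrite mulf_eq0 (negPf s0) => /eqP.
- have [d [a [b [d0 zE]]]] := f_span z.
  exists d, (a + b), (b * s); split=> //.
  by rewrite zE rmorphD rmorphM -mulrA swE; ring.
Qed.

Local Open Scope classical_set_scope.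

Theorem proposition1p2 (F : finFieldType) (L : fieldExtType F)
    (gamma : {lrmorphism {poly F} -> L}) (P : {poly F})
    (Lbar : closedFieldType) (iota : {rmorphism L -> Lbar})
    (Phi : drinfeld_module2 gamma) (c : {poly F}) (mu : F) (rho : {poly F}) :
  let m := residue_codegree gamma in
  let P_Phi : {poly {poly F}} := 'X^2 - c%:P * 'X + (mu *: P ^+ m)%:P in
  let Delta : {poly F} := c ^+ 2 - 4%:R * (mu *: P ^+ m) in
  integralRange iota ->
  P \is monic ->
  (forall a : {poly F}, gamma a = 0 <-> P %| a) ->
  ordinary Phi iota P ->
  mu != 0 ->
  is_Frob_char_poly Phi iota P P_Phi ->
  irreducible_poly rho ->
  ~~ (rho %= P) ->
  rho ^+ 2 %| P_Phi.[1] ->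
  rho %| c - 2%:R ->
  (torsion Phi iota rho `<=` range iota) <->
  (order_of_discriminant Phi (Delta %/ rho ^+ 2)
     `<=` endomorphisms_in_KFrob Phi).
Proof.
move=> m P_Phi Delta _ P_monic gamma_P P_ord _ F_char rho_irr rho_P rho2_dvd rho_dvd.
have [rho_size rho_div] := rho_irr.
have rho0 : rho != 0 by rewrite -size_poly_gt0 ltnW.
have gamma_rho0 : gamma rho != 0.
  (* [P] is not constant since gamma(1) = 1, so P | rho would make [P] an associate of the
     irreducible [rho]. *)
  apply/eqP => /gamma_P P_rho; have [P1|P1] := eqVneq (size P) 1%N.
    have /eqP := oner_neq0 L; apply; rewrite -(rmorph1 gamma); apply/gamma_P.
    by rewrite dvdp1 P1.
  by move: rho_P; rewrite eqp_sym rho_div.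
have F_root := eval_Frob_tate_char_poly rho_size gamma_rho0 (F_char _ rho_irr rho_P).
have F_out := ordinary_Frob_notin gamma_P P_ord.
have disc0 := Frob_discriminant_neq0 (residue_codegree_gt0 gamma) F_out P_ord F_root.
have f_indep := KFrobenius_independent F_root F_out.
pose N := mu *: P ^+ m.
have P_Phi1 : P_Phi.[1] = 1 - c + N.
  by rewrite /P_Phi !hornerE expr1n.
pose t := (c - 2%:R) %/ rho; pose n := P_Phi.[1] %/ rho ^+ 2.
have tE : c - 2%:R = t * rho by rewrite divpK.
have nE : 1 - c + N = n * rho ^+ 2 by rewrite -P_Phi1 divpK.
have [wE w_indep w_span] := affine_change_quadratic rho0
  (KFrobenius_quadratic F_root) f_indep (KFrobenius_spanning F_root f_indep) tE nE.
(* Translating F by 1 leaves the discriminant unchanged: Delta = (c - 2)^2 - 4 P_Phi(1). *)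
have DeltaE : Delta = (t ^+ 2 - 4%:R * n) * rho ^+ 2.
  transitivity ((c - 2%:R) ^+ 2 - 4%:R * (1 - c + N)); first by rewrite /Delta; ring.
  by rewrite tE nE; ring.
have disc_w0 : t ^+ 2 - 4%:R * n != 0.
  by apply: contraNneq disc0 => disc_w0; rewrite -/Delta DeltaE disc_w0 mul0r.
rewrite DeltaE mulpK ?expf_neq0 // (order_of_discriminantE wE w_indep w_span disc_w0).
rewrite (order_gen_endomorphisms _ rho0).
exact: torsion_rational_divides.
Qed.
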